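(* For $1\le\tau\le m$ let $(\rho^{(\tau)}_i)_{i\ge1}$ be real numbers (possibly different for different $\tau$) and let $(a^{(\tau)}_{ij})_{i,j\ge1}$ be real random variables such that $\{a^{(\tau)}_{ii}:i\ge1\}\cup\{(a^{(\tau)}_{ij},a^{(\tau)}_{ji}):1\le i<j\}$ is an independent collection, $\mathbf{E}[a^{(\tau)}_{ij}]=0$ and $\mathbf{E}[(a^{(\tau)}_{ij})^2]=1$ for all $i,j$, $\sup_{i,j}\mathbf{E}|a^{(\tau)}_{ij}|^q<\infty$ for every $q\in\mathbb{N}$, and $\mathbf{E}[a^{(\tau)}_{ij}a^{(\tau)}_{ji}]=\rho^{(\tau)}_{|i-j|}$ for all $i\ne j$. Assume the $m$ arrays are independent. Let $X^{(\tau)}_{p\times n}=(a^{(\tau)}_{ij})_{1\le i\le p,\,1\le j\le n}$ and $\bar X^{(\tau)}_p=\frac1nX^{(\tau)}_{p\times n}\big(X^{(\tau)}_{p\times n}\big)'$, where $'$ denotes transpose and $n=n(p)$. If $\frac pn\to y>0$ as $p\to\infty$, then $\bar X^{(1)}_p,\ldots,\bar X^{(m)}_p$ are asymptotically free.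
   Context: A non-commutative probability space (NCP) $(\mathcal{A},\varphi)$ is a unital complex $*$-algebra with a state. For $p\times p$ random matrices with all moments finite, $\varphi_p(x)=\frac1p\mathbf{E}\,\mathrm{Tr}(x)$. Symmetric random matrices $B_p^{(1)},\ldots,B_p^{(m)}$ (of size $p\times p$) are asymptotically free if they converge jointly in $*$-distribution, i.e. there are self-adjoint $b_1,\ldots,b_m$ in some NCP $(\mathcal{A},\varphi)$ with $\lim_p\varphi_p(B_p^{(\tau_1)}\cdots B_p^{(\tau_k)})=\varphi(b_{\tau_1}\cdots b_{\tau_k})$ for all $k$ and all $\tau_1,\ldots,\tau_k\in\{1,\ldots,m\}$, and $b_1,\ldots,b_m$ are free. Here $b_1,\ldots,b_m$ are free if $\varphi(q_1(b_{i(1)})\cdots q_k(b_{i(k)}))=0$ for all polynomials $q_1,\ldots,q_k$ whenever $\varphi(q_j(b_{i(j)}))=0$ for $1\le j\le k$ and $i(1)\ne i(2)\ne\cdots\ne i(k)$ (consecutive indices differ). *)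

(* Defs.v *)
From HB Require Import structures.
From mathcomp Require Import all_boot all_order all_algebra finmap complex.
From mathcomp Require Import all_classical all_reals all_analysis.

Set Implicit Arguments.
Unset Strict Implicit.
Unset Printing Implicit Defensive.

Import Order.TTheory GRing.Theory Num.Theory.
Import numFieldNormedType.Exports.

Local Open Scope classical_set_scope.
Local Open Scope ring_scope.

(* Scalars are the complex numbers [R[i]] over an [R : realType]; the
   definitions on *-algebras make sense over any [numClosedFieldType], where
   [0 <= z] means that [z] is real and nonnegative. *)

Record star_operation (C : numClosedFieldType) (A : algType C) := StarOperation {
  star_fun :> A -> A ;
  starD : forall x y, star_fun (x + y) = star_fun x + star_fun y ;
  starZ : forall (c : C) x, star_fun (c *: x) = c^* *: star_fun x ;
  starM : forall x y, star_fun (x * y) = star_fun y * star_fun x ;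
  starK : involutive star_fun }.

Record ncp (C : numClosedFieldType) := NCP {
  ncp_alg :> algType C ;
  star : star_operation ncp_alg ;
  state : {linear ncp_alg -> C^o} ;
  state1 : state 1 = 1 ;
  state_ge0 : forall x : ncp_alg, 0 <= state (star x * x) }.

(* At k = 0 the empty product has state 1, hence the restriction 0 < k. *)
Definition free_family (C : numClosedFieldType) (A : ncp C) (m : nat)
    (b : 'I_m -> A) : Prop :=
  forall (k : nat) (i : nat -> 'I_m) (q : nat -> {poly C}),
    (0 < k)%N ->
    (forall j, (j < k)%N -> state A (horner_alg (b (i j)) (q j)) = 0) ->
    (forall j, (j.+1 < k)%N -> i j != i j.+1) ->
    state A (\prod_(j < k) horner_alg (b (i j)) (q j)) = 0.

Section random.
Context d (T : measurableType d) (R : realType) (P : probability T R).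

(* [F i] is meant to be a sigma-algebra of events; only the [F i] with [i] in
   the possibly infinite index set [D] are required to be independent. *)
Definition independent (I : choiceType) (D : set I)
    (F : I -> set_system T) : Prop :=
  forall J : {fset I}, [set` J] `<=` D ->
  forall E : I -> set T, (forall i, i \in J -> F i (E i)) ->
    P (\bigcap_(i in [set` J]) E i) = (\prod_(i <- J) P (E i))%E.

Definition sigma_rv d' (T' : measurableType d') (X : T -> T') : set_system T :=
  preimage_set_system setT X measurable.

(* For [i <= j], the pairs [(i, j)] index the independent blocks of the array:
   the diagonal entries [a i i] and the pairs [(a i j, a j i)] with [i < j].
   Rows and columns are numbered from 0. *)
Definition entry_sigma (a : nat -> nat -> {RV P >-> R}) (ij : nat * nat) :
    set_system T :=
  let: (i, j) := ij in
  if i == j then sigma_rv (a i i)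
  else sigma_rv (fun w => (a i j w, a j i w)).

Definition array_sigma (a : nat -> nat -> {RV P >-> R}) : set_system T :=
  <<s \bigcup_(ij in [set: nat * nat]) sigma_rv (a ij.1 ij.2) >>.

(* [fine] sends infinite values to 0; [phi] is only used on matrices whose
   entries have finite moments (see [finite_moments]), where the expectation is
   finite. The matrices are real, so that [phi] is real-valued; it is embedded
   in [R[i]] in [asymptotically_free]. *)
Definition phi (p : nat) (B : T -> 'M[R]_p) : R :=
  p%:R^-1 * fine 'E_P[fun w => \tr (B w)].

Definition finite_moments (p : nat) (B : T -> 'M[R]_p) : Prop :=
  forall i j, measurable_fun setT (fun w => B w i j) /\
    forall q : nat, ('E_P[fun w => (`|B w i j| ^+ q)%R] < +oo)%E.

(* Convergence is for the modulus on [R[i]], whose topology is carried by the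
   alias [R[i]^o]. *)
Definition asymptotically_free (m : nat)
    (B : 'I_m -> forall p, T -> 'M[R]_p) : Prop :=
  [/\ forall t p w, (B t p w)^T = B t p w,
      forall t p, finite_moments (B t p) &
      exists (A : ncp R[i]) (b : 'I_m -> A),
        [/\ forall t, star A (b t) = b t,
            forall tau : seq 'I_m,
              ((phi (fun w => \prod_(t <- tau) B t p w))%:C%C : R[i]^o)
                @[p --> \oo] --> state A (\prod_(t <- tau) b t) &
            free_family b]].

Definition data_matrix (a : nat -> nat -> {RV P >-> R}) (p n : nat) (w : T) :
    'M[R]_(p, n) :=
  \matrix_(i < p, j < n) a i j w.

Definition sample_cov (a : nat -> nat -> {RV P >-> R}) (n : nat -> nat)
    (p : nat) (w : T) : 'M[R]_p :=
  (n p)%:R^-1 *: (data_matrix a p (n p) w *m (data_matrix a p (n p) w)^T).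

End random.

(* Main.v *)
Require Import Defs.
From HB Require Import structures.
From mathcomp Require Import all_boot all_order all_algebra finmap complex.
From mathcomp Require Import all_classical all_reals all_analysis.
From mathcomp Require Import measurable_realfun ring lra zify.
From mathcomp Require Import -(notations) monalg.

Set Implicit Arguments.
Unset Strict Implicit.
Unset Printing Implicit Defensive.

Import Order.TTheory GRing.Theory Num.Theory.
Import numFieldNormedType.Exports.

Local Open Scope classical_set_scope.
Local Open Scope ring_scope.

(** Why the theorem is true.

    The trace of a product of sample covariance matrices is a sum over closed
    walks [v0, v1, .., v2k] in which rows and columns alternate; each step reads
    one matrix entry and carries the colour of its array ([phi_expansion]).
    Number rows and columns by the same integers and forget the directions: the
    entries read at different undirected coloured edges are independent, because
    [a i j] depends on [a j i] only.  As entries are centred, a walk has vanishing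
    mean unless all its edges are used at least twice ([word_mean_lonely]).  Such a
    walk of length [2k] discovers at most [k] new vertices ([fresh_bound]).  If it
    discovers exactly [k] of them, it is a depth-first exploration of a tree that
    crosses every edge once in each direction and in one colour ([tight_good]).
    The two crossings read the same entry, and not its mirror image: between them
    the walk makes an even number of steps, so that rows and columns exchange their
    roles together with the end points ([good_keys]).  The mean of the product is
    then a product of variances, equal to [1], and the correlation of [a i j] with
    [a j i] does not enter the limit.  The other walks carry a spare factor [1 / n],
    and their total weight is bounded ([sum_fresh_weight], [walk_defect]).

    Reading a tree walk step by step, the edges that are open form a stack of
    colours: a step pushes its colour, with a weight given by the number of vertices
    to choose from, or pops the same colour.  Hence the limit of the mixed moments
    is the vacuum moment of the operators on functions of stacks of colours defined
    by pushing and popping ([good_sum_cvg], [phi_cvg]).  With suitable weights of the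
    stacks these operators are self-adjoint, which makes the limit a state on the
    free *-algebra ([poisson_state_ge0]).  The operator of one colour sees only the
    letters of that colour on top of the stack and acts in the same way whatever
    lies under them; so a polynomial in it with vanishing state leaves at least one
    letter of its colour on top of any stack that does not begin with this colour, and an
    alternating product of such polynomials never returns to the empty stack
    ([poisson_free]). *)

(** * Free Poisson operators on stacks *)

Section fock.
Context (I : finType) (C : comNzRingType) (y : C).
Implicit Types (f g : seq I -> C) (s : seq I) (t : I) (w : seq I).

(** One step of a walk whose open edges form the stack of colours [s], the walk
    being read from its start: push the colour [t], with weight [z] for the choice
    of a new vertex, or pop it.  Acting on functions of the stack, rather than on
    combinations of stacks, avoids any condition of finite support. *)
Definition hop (z : C) t f s : C :=
  z * f (t :: s) + (if s is t' :: s' then (if t' == t then f s' else 0) else 0).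

Definition vacuum s : C := (s == [::])%:R.

(** A sample covariance matrix makes two steps, from a row to a column and from a
    column to a row; [y] is the limiting ratio of rows to columns. *)
Definition poisson t f := hop 1 t (hop y t f).

Definition poisson_word w f := foldr poisson f w.

(** The mixed moments of free Poisson variables: noncrossing pairings of the doubled
    word, each pair matching equal letters, are counted with weight [y] for each
    pair that opens at the second copy of a letter. *)
Definition fock_moment w : C := poisson_word w vacuum [::].

Lemma eq_hop z t f g : f =1 g -> hop z t f =1 hop z t g.
Proof.
by move=> fg [|t' s]; rewrite /hop fg //; case: eqP => // _; rewrite fg.
Qed.

Lemma eq_poisson t f g : f =1 g -> poisson t f =1 poisson t g.
Proof. by move=> fg; do 2 apply: eq_hop. Qed.

Lemma eq_poisson_word w f g : f =1 g -> poisson_word w f =1 poisson_word w g.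
Proof. by move=> fg; elim: w => //= t w IH; exact: eq_poisson. Qed.

Lemma hop_sum (J : Type) (r : seq J) (c : J -> C) (F : J -> seq I -> C) z t s :
  hop z t (fun s => \sum_(j <- r) c j * F j s) s = \sum_(j <- r) c j * hop z t (F j) s.
Proof.
rewrite /hop; under [RHS]eq_bigr do rewrite mulrDr.
rewrite big_split /= mulr_sumr; congr (_ + _).
  by apply: eq_bigr => j _; rewrite mulrCA.
case: s => [|t' s]; first by rewrite big1 // => j _; rewrite mulr0.
by case: ifP => // _; rewrite big1 // => j _; rewrite mulr0.
Qed.

Lemma poisson_word_sum (J : Type) (r : seq J) (c : J -> C)
    (F : J -> seq I -> C) w s :
  poisson_word w (fun s => \sum_(j <- r) c j * F j s) s =
  \sum_(j <- r) c j * poisson_word w (F j) s.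
Proof.
elim: w s => //= t w IH s; rewrite (eq_poisson _ IH).
rewrite /poisson -hop_sum; apply: eq_hop => s'.
by rewrite -hop_sum.
Qed.

(** The sum over the stacks of height at most [K], organised by top letters so that
    a letter can be pushed or popped under the sum. *)
Fixpoint stack_sum K (F : seq I -> C) : C :=
  F [::] + (if K is K'.+1 then \sum_t stack_sum K' (fun s => F (t :: s)) else 0).

Lemma eq_stack_sum K (F G : seq I -> C) : F =1 G -> stack_sum K F = stack_sum K G.
Proof.
elim: K F G => [|K IH] F G FG /=; rewrite FG //.
by congr (_ + _); apply: eq_bigr => t _; apply: IH => s; rewrite FG.
Qed.

Lemma stack_sum_sum (J : Type) (r : seq J) (F : J -> seq I -> C) K :
  stack_sum K (fun s => \sum_(j <- r) F j s) = \sum_(j <- r) stack_sum K (F j).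
Proof.
elim: K F => [|K IH] F /=; first by rewrite addr0; under [RHS]eq_bigr do rewrite addr0.
rewrite big_split /=; congr (_ + _); rewrite exchange_big /=.
by apply: eq_bigr => t _; rewrite IH.
Qed.

Lemma stack_sumD (F G : seq I -> C) K :
  stack_sum K (fun s => F s + G s) = stack_sum K F + stack_sum K G.
Proof.
elim: K F G => [|K IH] F G /=; first by rewrite !addr0.
rewrite addrACA -big_split /=; congr (_ + _).
by apply: eq_bigr => t _; rewrite IH.
Qed.

Lemma stack_sumZ (c : C) (F : seq I -> C) K :
  stack_sum K (fun s => c * F s) = c * stack_sum K F.
Proof.
elim: K F => [|K IH] F /=; first by rewrite !addr0.
by rewrite mulrDr mulr_sumr; congr (_ + _); apply: eq_bigr => t _; rewrite IH.
Qed.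

Lemma stack_sum0 K : stack_sum K (fun=> 0) = 0.
Proof. by elim: K => [|K IH] /=; rewrite ?add0r // big1. Qed.

Lemma stack_sumS K (F : seq I -> C) :
  (forall s, (K < size s)%N -> F s = 0) -> stack_sum K.+1 F = stack_sum K F.
Proof.
elim: K F => [|K IH] F F0 /=; congr (_ + _).
  by rewrite big1 // => t _; rewrite F0 // addr0.
by apply: eq_bigr => t _; apply: IH => s Ks; apply: F0.
Qed.

Lemma stack_sum_head K t (F : seq I -> C) :
  stack_sum K.+1 (fun s => if s is t' :: s' then (if t' == t then F s' else 0) else 0)
  = stack_sum K F.
Proof.
rewrite [LHS]/= add0r (bigD1 t) //= eqxx big1 ?addr0 //.
by move=> t' /negPf ->; rewrite stack_sum0.
Qed.

(** Truncated sums lose nothing on functions that vanish on high stacks. *)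
Definition low K f := forall s, (K < size s)%N -> f s = 0.

Lemma low_hop z t K f : low K f -> low K.+1 (hop z t f).
Proof.
move=> lf s Ks; rewrite /hop lf ?mulr0 ?add0r /=; last by apply: ltnW; apply: ltnW.
by case: s Ks => // t' s Ks; rewrite lf ?if_same.
Qed.

Lemma low_poisson_word w K f : low K f -> low ((size w).*2 + K) (poisson_word w f).
Proof. by move=> lf; elim: w => //= t w IH; do 2 apply: low_hop. Qed.

Lemma low_le K K' f : (K <= K')%N -> low K f -> low K' f.
Proof. by move=> KK lf s Ks; apply: lf; apply: leq_ltn_trans Ks. Qed.

Lemma low_vacuum : low 0 vacuum. Proof. by case. Qed.

(** Two inner products are needed, with weights [y ^ uphalf] and [y ^ half] of the
    height: the steps [hop 1] and [hop y] are not self-adjoint, but adjoint to each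
    other from one inner product to the other. *)
Definition stack_form (h : nat -> nat) K f g :=
  stack_sum K (fun s => y ^+ h (size s) * (f s * g s)).

Lemma stack_formC h K f g : stack_form h K f g = stack_form h K g f.
Proof. by apply: eq_stack_sum => s; rewrite [f s * _]mulrC. Qed.

(** Pushing [t] on [s] on one side is matched by popping it on the other, since
    [uphalf] of a height is [half] of the next one, and [uphalf] of that next one is
    one more than [half] of the height, which yields the factor [y]. *)
Lemma stack_form_hop K t f g : low K f -> low K g ->
  stack_form uphalf K.+1 f (hop 1 t g) = stack_form half K.+1 (hop y t f) g.
Proof.
move=> lf lg; rewrite /stack_form.
transitivity (stack_sum K (fun s => y ^+ uphalf (size s) * (f s * g (t :: s)))
   + stack_sum K (fun s => y ^+ uphalf (size s).+1 * (f (t :: s) * g s))).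
  rewrite -[X in _ + X](stack_sum_head K t) -[X in X + _]stack_sumS; last first.
    by move=> s Ks; rewrite lf // mul0r mulr0.
  rewrite -stack_sumD; apply: eq_stack_sum => -[|t' s]; rewrite /hop.
    by rewrite mul1r !addr0.
  rewrite mul1r !mulrDr; congr (_ + _); case: eqVneq => [-> //|_].
  by rewrite !mulr0.
rewrite addrC -[X in _ + X](stack_sum_head K t) -[X in X + _]stack_sumS; last first.
  by move=> s Ks; rewrite lg // !mulr0.
rewrite -stack_sumD; apply: eq_stack_sum => -[|t' s]; rewrite /hop.
  by rewrite /= expr1 !addr0 !expr0 mul1r mulrA.
rewrite mulrDl mulrDr; congr (_ + _); first by rewrite exprSr !mulrA.
by case: eqVneq => [-> //|_]; rewrite mul0r mulr0.
Qed.

Lemma stack_form_poisson K t f g : low K f -> low K g ->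
  stack_form uphalf K.+2 f (poisson t g) = stack_form uphalf K.+2 (poisson t f) g.
Proof.
move=> lf lg; have KS : (K <= K.+1)%N by [].
have lf' := low_le KS lf; have lg' := low_le KS lg.
rewrite (stack_form_hop _ lf' (low_hop _ _ lg)) stack_formC.
by rewrite -(stack_form_hop _ lg' (low_hop _ _ lf)) stack_formC.
Qed.

Lemma stack_form_poisson_word w K N f g : low K f -> low K g ->
  ((size w).*2 + K <= N)%N ->
  stack_form uphalf N (poisson_word w f) g = stack_form uphalf N f (poisson_word (rev w) g).
Proof.
elim: w K N f g => //= t w IH K N f g lf lg KN; rewrite rev_cons -cats1.
rewrite /poisson_word foldr_cat /= -/(poisson_word _ _) -/(poisson_word _ _).
rewrite doubleS !addSn in KN.
case: N KN => // -[//|N]; rewrite !ltnS => KN.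
rewrite -stack_form_poisson; last 2 first.
- by apply: low_le KN _; apply: low_poisson_word.
- by apply: low_le lg; apply: leq_trans KN; rewrite leq_addl.
apply: (IH K.+2).
- by apply: low_le lf; rewrite -addn2 leq_addr.
- by do 2 apply: low_hop.
- by rewrite !addnS !ltnS.
Qed.

Lemma stack_form_vacuum N f : stack_form uphalf N vacuum f = f [::].
Proof.
rewrite /stack_form.
case: N => [|N] /=; rewrite /vacuum expr0 !mul1r ?addr0 //.
rewrite big1 ?addr0 // => t _; rewrite -[RHS](stack_sum0 N).
by apply: eq_stack_sum => s; rewrite mul0r mulr0.
Qed.

(** The function [c (x) f] under the decomposition of a stack into the number of
    letters [t] on its top and the rest. *)
Definition on_top t (c : nat -> C) f s : C :=
  let j := find (predC1 t) s in c j * f (drop j s).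

Definition hop_coef z (c : nat -> C) j : C :=
  z * c j.+1 + (if j is j'.+1 then c j' else 0).

Lemma hop_on_top z t c f :
  hop z t (on_top t c f) =1 on_top t (hop_coef z c) f.
Proof.
move=> [|t' s]; rewrite /hop /on_top /hop_coef /= eqxx /=.
  by rewrite mulrDl mul0r mulrA.
case: eqVneq => [->|_] /=; last by rewrite mulrDl mul0r mulrA.
by rewrite mulrDl mulrA.
Qed.

Definition poisson_coef i : nat -> C :=
  iter i (fun c => hop_coef 1 (hop_coef y c)) (fun j => (j == 0%N)%:R).

(** The letter [t] acts on the number of letters [t] on top of the stack only, in the
    same way whatever lies under them.  Freeness of the limit rests on this. *)
Lemma poisson_nseq_on_top t i f : (forall s, f (t :: s) = 0) ->
  poisson_word (nseq i t) f =1 on_top t (poisson_coef i) f.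
Proof.
move=> f0; elim: i => [|i IH] s /=.
  rewrite /on_top /poisson_coef /=; case: s => [|t' s] /=; first by rewrite mul1r.
  by have [->|_] := eqVneq t' t; rewrite /= ?f0 ?mul0r ?mul1r.
rewrite (eq_poisson t IH) /poisson (eq_hop _ _ (hop_on_top _ _ _ _)).
by rewrite hop_on_top.
Qed.

End fock.

Lemma fock_moment_morph (I : finType) (C C' : comNzRingType)
    (h : {rmorphism C -> C'}) (y : C) (w : seq I) :
  h (fock_moment y w) = fock_moment (h y) w.
Proof.
suff H f g : (forall s, h (f s) = g s) -> forall s : seq I,
    h (poisson_word y w f s) = poisson_word (h y) w g s.
  by apply: H => s; rewrite rmorph_nat.
move=> fg; elim: w => //= t w IH.
have hop_h z f' g' : (forall s : seq I, h (f' s) = g' s) ->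
    forall s, h (hop z t f' s) = hop (h z) t g' s.
  move=> fg' [|t' s]; rewrite /hop rmorphD rmorphM fg' ?rmorph0 //.
  by case: ifP => _; rewrite ?fg' ?rmorph0.
move=> s; rewrite /poisson -[X in _ = hop X _ _ _](rmorph1 h).
by apply: (hop_h); apply: (hop_h).
Qed.

(** * The free *-algebra on self-adjoint generators *)

(** The free unital *-algebra on self-adjoint generators indexed by [I], described
    by what determines it: the words span it, linear functionals can be prescribed
    on them, and the adjoint reverses them. *)
Record free_star_algebra (I : Type) (C : numClosedFieldType) := FreeStarAlgebra {
  free_alg :> algType C ;
  word : seq I -> free_alg ;
  word_nil : word [::] = 1 ;
  word_cat : forall v w, word (v ++ w) = word v * word w ;
  word_span : forall x, exists r : seq (C * seq I),
    x = \sum_(u <- r) u.1 *: word u.2 ;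
  extend : (seq I -> C) -> {linear free_alg -> C^o} ;
  extend_word : forall l w, extend l (word w) = l w ;
  free_star : star_operation free_alg ;
  star_word : forall w, free_star (word w) = word (rev w) }.

(** Laws that an algebra spanned by words inherits from the words. *)
Section spanned_by_words.
Context (I : Type) (C : numClosedFieldType) (A : lalgType C).
Context (w : seq I -> A) (adj : A -> A).
Hypothesis w_ind : forall Q : A -> Prop, (forall x z, Q x -> Q z -> Q (x + z)) ->
  (forall c s, Q (c *: w s)) -> forall x, Q x.
Hypothesis wM : forall c d s t, (c *: w s) * (d *: w t) = (c * d) *: w (s ++ t).

Lemma words_scaleAr (c : C) (x z : A) : c *: (x * z) = x * (c *: z).
Proof.
elim/w_ind: x => [x x' IH IH'|d s]; first by rewrite !mulrDl scalerDr IH IH'.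
elim/w_ind: z => [x x' IH IH'|e t]; first by rewrite scalerDr !mulrDr scalerDr IH IH'.
by rewrite scalerA !wM scalerA mulrCA.
Qed.

Lemma words_span (x : A) : exists r : seq (C * seq I),
  x = \sum_(u <- r) u.1 *: w u.2.
Proof.
elim/w_ind: x => [x z [r ->] [r' ->]|c s].
  by exists (r ++ r'); rewrite big_cat.
by exists [:: (c, s)]; rewrite big_seq1.
Qed.

Hypothesis adjD : forall x z, adj (x + z) = adj x + adj z.
Hypothesis adjZ : forall c x, adj (c *: x) = c^* *: adj x.
Hypothesis adj_word : forall s, adj (w s) = w (rev s).

Lemma words_adjM x z : adj (x * z) = adj z * adj x.
Proof.
elim/w_ind: x => [x x' IH IH'|c s]; first by rewrite mulrDl !adjD IH IH' mulrDr.
elim/w_ind: z => [z z' IH IH'|d t]; first by rewrite mulrDr !adjD IH IH' mulrDl.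
by rewrite wM !adjZ !adj_word wM rev_cat rmorphM [_^* * _]mulrC.
Qed.

Lemma words_adjK : involutive adj.
Proof.
elim/w_ind => [x z IH IH'|c s]; first by rewrite !adjD IH IH'.
by rewrite !adjZ !adj_word conjCK revK.
Qed.

End spanned_by_words.

Section free_star_algebra_construction.
Context (I : finType) (C : numClosedFieldType).

Let A : Type := malg (fmonom I) C.
HB.instance Definition _ := GRing.Lalgebra.on A.

Let mword (w : seq I) : A := mkmalgU (FMonom w) 1.

Let scale_mword c w : c *: mword w = mkmalgU (FMonom w) c.
Proof. by apply/malgP => k; rewrite [LHS]mcoeffZ !mcoeffU mulrnAr mulr1. Qed.

Let mword_cat v w : mword (v ++ w) = mword v * mword w.
Proof.
by rewrite malgM_def fgmulUU mulr1; congr mkmalgU; apply/eqP; rewrite fmP fmM.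
Qed.

Let mword_nil : mword [::] = 1.
Proof. by congr mkmalgU; apply/eqP; rewrite fmP fm1. Qed.

Let mword_ind (Q : A -> Prop) : (forall x z, Q x -> Q z -> Q (x + z)) ->
  (forall c w, Q (c *: mword w)) -> forall x, Q x.
Proof.
move=> QD Qw x; rewrite (monalgE x).
elim/big_ind: _ => //; first by rewrite -(scale0r (mword [::])).
by move=> k _; case: k => w; rewrite -scale_mword.
Qed.

Let mwordM c d v w :
  (c *: mword v) * (d *: mword w) = (c * d) *: mword (v ++ w).
Proof.
rewrite !scale_mword malgM_def fgmulUU; congr mkmalgU.
by apply/eqP; rewrite fmP fmM.
Qed.

Let scaleAr (c : C) (x z : A) : c *: (x * z) = x * (c *: z).
Proof. exact: (words_scaleAr mword_ind mwordM). Qed.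

HB.instance Definition _ := GRing.Lalgebra_isAlgebra.Build C A scaleAr.

Let mextend (l : seq I -> C) (x : A) : C^o :=
  \sum_(k <- msupp x) mcoeff k x * l k.

Let mextend_is_additive l : additive (mextend l).
Proof. exact: (@mmap_is_additive _ _ _ idfun (fun k : fmonom I => l k)). Qed.

HB.instance Definition _ l :=
  GRing.isAdditive.Build A C^o (mextend l) (mextend_is_additive l).

Let mextend_is_scalable l : scalable (mextend l).
Proof.
move=> c x; rewrite /mextend (big_fset_incl _ (msuppZ_le c x)) => [|k _].
  by rewrite scaler_sumr; apply: eq_bigr => k _; rewrite mcoeffZ -mulrA.
by move=> /mcoeff_outdom ->; rewrite mul0r.
Qed.

HB.instance Definition _ l :=
  GRing.isScalable.Build C A C^o *:%R (mextend l) (mextend_is_scalable l).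

Let mextend_word l w : mextend l (mword w) = l w.
Proof.
have := @mmapU _ _ _ idfun (fun k : fmonom I => l k) 1 (FMonom w).
by rewrite /mmap /= mul1r.
Qed.

Let adjoint (x : A) : A :=
  \sum_(k <- msupp x) (mcoeff k x)^* *: mword (rev k).

Let adjoint_w (d : {fset fmonom I}) x : (msupp x `<=` d)%fset ->
  adjoint x = \sum_(k <- d) (mcoeff k x)^* *: mword (rev k).
Proof.
move=> xd; rewrite /adjoint (big_fset_incl _ xd) // => k _ /mcoeff_outdom ->.
by rewrite conjC0 scale0r.
Qed.

Let adjointD x z : adjoint (x + z) = adjoint x + adjoint z.
Proof.
rewrite (adjoint_w (msuppD_le x z)) (adjoint_w (fsubsetUl (msupp x) (msupp z))).
rewrite (adjoint_w (fsubsetUr (msupp x) (msupp z))) -big_split /=.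
by apply: eq_bigr => k _; rewrite mcoeffD rmorphD scalerDl.
Qed.

Let adjointZ c x : adjoint (c *: x) = c^* *: adjoint x.
Proof.
rewrite (adjoint_w (msuppZ_le c x)) scaler_sumr.
by apply: eq_bigr => k _; rewrite mcoeffZ rmorphM scalerA.
Qed.

Let adjoint_word w : adjoint (mword w) = mword (rev w).
Proof.
by rewrite (adjoint_w msuppU_le) big_seq_fset1 mcoeffUU conjC1 scale1r.
Qed.

Let adjointM := words_adjM mword_ind mwordM adjointD adjointZ adjoint_word.

Let adjointK := words_adjK mword_ind adjointD adjointZ adjoint_word.

Lemma free_star_algebra_exists : free_star_algebra I C.
Proof.
exact: (@FreeStarAlgebra I C (A : algType C) mword mword_nil mword_cat (words_span mword_ind)
  (fun l => mextend l) mextend_word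
  (StarOperation adjointD adjointZ adjointM adjointK) adjoint_word).
Qed.

End free_star_algebra_construction.

(** * Positivity and freeness of the limit *)

Section poisson_ncp.
Context (I : finType) (C : numClosedFieldType) (y : C) (y_ge0 : 0 <= y).

Let A : free_star_algebra I C := free_star_algebra_exists I C.

Definition poisson_state : {linear A -> C^o} := extend A (fock_moment y).

Lemma poisson_word_real (w s : seq I) :
  (poisson_word y w (vacuum C) s)^* = poisson_word y w (vacuum C) s.
Proof.
elim: w s => [|t w IH] s /=; first by rewrite /vacuum conjC_nat.
have yR : y^* = y by apply: conj_Creal; apply: ger0_real.
have hopR z f : z^* = z -> (forall s, (f s)^* = f s) ->
    forall s : seq I, (hop z t f s)^* = hop z t f s.
  move=> zR fR [|t' s']; rewrite /hop rmorphD rmorphM /= zR fR ?conjC0 //.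
  by case: ifP => _; rewrite ?fR ?conjC0.
by apply: (hopR); [exact: conjC1|apply: (hopR)].
Qed.

(** The moment is the inner product of the vectors created from the vacuum by [v] and
    by [w]. *)
Lemma fock_moment_rev_cat (v w : seq I) N :
  ((size v).*2 + (size w).*2 <= N)%N ->
  fock_moment y (rev v ++ w) =
  stack_form y uphalf N (poisson_word y v (vacuum C)) (poisson_word y w (vacuum C)).
Proof.
move=> vwN; have lw := @low_poisson_word I C y w 0 _ (@low_vacuum I C).
rewrite addn0 in lw.
rewrite (stack_form_poisson_word _ _ lw vwN); last exact: low_le (@low_vacuum I C).
by rewrite stack_form_vacuum /fock_moment /poisson_word foldr_cat.
Qed.

Lemma poisson_state_word (w : seq I) : poisson_state (word A w) = fock_moment y w.
Proof. exact: extend_word. Qed.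

Lemma stack_sum_ge0 N (F : seq I -> C) :
  (forall s, 0 <= F s) -> 0 <= stack_sum N F.
Proof.
elim: N F => [|N IH] F F0 /=; first by rewrite addr0.
by rewrite addr_ge0 // sumr_ge0 // => t _; apply: IH.
Qed.

Lemma star_sum (r : seq (C * seq I)) :
  free_star A (\sum_(u <- r) u.1 *: word A u.2) =
  \sum_(u <- r) u.1^* *: word A (rev u.2).
Proof.
have star0 : free_star A 0 = 0 by rewrite -[X in free_star A X](scale0r (0 : A)) starZ conjC0 scale0r.
rewrite (big_morph _ (starD (free_star A)) star0).
by apply: eq_bigr => u _; rewrite starZ star_word.
Qed.

(** [poisson_state] is the vector state of the vacuum: its value at [x^* x] is the
    squared norm of the vector that [x] creates from the vacuum. *)
Lemma poisson_state_ge0 (x : A) : 0 <= poisson_state (free_star A x * x).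
Proof.
have [r ->] := word_span x.
pose N := (\max_(u <- r) size u.2).*2.
have sizeN u : u \in r -> ((size u.2).*2 <= N)%N.
  by move=> ur; rewrite leq_double; exact: (@leq_bigmax_seq _ r xpredT (fun u => size u.2) u).
pose V (u : C * seq I) := poisson_word y u.2 (vacuum C).
suff -> : poisson_state (free_star A (\sum_(u <- r) u.1 *: word A u.2) *
      (\sum_(u <- r) u.1 *: word A u.2)) = stack_sum (N + N) (fun s =>
    y ^+ uphalf (size s) * `|\sum_(u <- r) u.1 * V u s| ^+ 2).
  by apply: stack_sum_ge0 => s; rewrite mulr_ge0 ?exprn_ge0.
transitivity (\sum_(u <- r) \sum_(v <- r)
    (u.1^* * v.1) * stack_form y uphalf (N + N) (V u) (V v)).
  rewrite star_sum mulr_suml linear_sum /=.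
  apply: eq_big_seq => u ur; rewrite mulr_sumr linear_sum /=.
  apply: eq_big_seq => v vr.
  rewrite -scalerAl -scalerAr -word_cat scalerA linearZ /= poisson_state_word.
  by rewrite (@fock_moment_rev_cat _ _ (N + N)) // leq_add ?sizeN.
transitivity (stack_sum (N + N) (fun s => \sum_(u <- r) \sum_(v <- r)
   (u.1^* * v.1) * (y ^+ uphalf (size s) * (V u s * V v s)))).
  rewrite stack_sum_sum; apply: eq_bigr => u _.
  by rewrite stack_sum_sum; apply: eq_bigr => v _; rewrite stack_sumZ.
apply: eq_stack_sum => s; rewrite normCK [X in _ * X]mulrC rmorph_sum big_distrlr /=.
rewrite mulr_sumr; apply: eq_bigr => u _; rewrite mulr_sumr; apply: eq_bigr => v _.
rewrite rmorphM /= /V poisson_word_real; ring.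
Qed.

Lemma poisson_state1 : poisson_state 1 = 1.
Proof.
by rewrite -word_nil poisson_state_word /fock_moment /= /vacuum eqxx.
Qed.

Definition poisson_ncp : ncp C :=
  @NCP C A (free_star A) poisson_state poisson_state1 poisson_state_ge0.

(** The representation of the free algebra on functions of stacks. *)
Definition fock_act (x : A) (f : seq I -> C) (s : seq I) : C :=
  extend A (fun w => poisson_word y w f s) x.

Lemma fock_act_word w f s : fock_act (word A w) f s = poisson_word y w f s.
Proof. exact: extend_word. Qed.

Lemma fock_act_sum (r : seq (C * seq I)) f s :
  fock_act (\sum_(u <- r) u.1 *: word A u.2) f s =
  \sum_(u <- r) u.1 * poisson_word y u.2 f s.
Proof.
rewrite /fock_act linear_sum; apply: eq_bigr => u _.
by rewrite linearZ /= extend_word.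
Qed.

Lemma poisson_state_act x : poisson_state x = fock_act x (vacuum C) [::].
Proof.
have [r ->] := word_span x; rewrite fock_act_sum /poisson_state linear_sum.
by apply: eq_bigr => u _; rewrite linearZ /= extend_word.
Qed.

Lemma fock_act_mul x z f s : fock_act (x * z) f s = fock_act x (fock_act z f) s.
Proof.
have [r ->] := word_span x; have [r' ->] := word_span z.
rewrite mulr_suml [LHS]linear_sum fock_act_sum; apply: eq_bigr => u _.
rewrite (eq_poisson_word _ _ (fock_act_sum _ _)) poisson_word_sum.
rewrite mulr_sumr linear_sum mulr_sumr; apply: eq_bigr => v _.
rewrite -scalerAl -scalerAr -word_cat !linearZ /= extend_word.
by rewrite /poisson_word foldr_cat.
Qed.

Lemma fock_act_horner t q f : (forall s, f (t :: s) = 0) ->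
  fock_act (horner_alg (word A [:: t]) q) f =1
  on_top t (fun j => \sum_(i < size q) q`_i * poisson_coef y i j) f.
Proof.
move=> f0 s.
have wX i : word A [:: t] ^+ i = word A (nseq i t).
  elim: i => [|i IH]; first by rewrite word_nil.
  by rewrite exprS IH -word_cat.
have -> : horner_alg (word A [:: t]) q =
    \sum_(u <- [seq (q`_i, nseq (nat_of_ord i) t) | i : 'I_(size q)]) u.1 *: word A u.2.
  rewrite big_image /= -{1}(coefK q) poly_def rmorph_sum /=.
  apply: eq_bigr => i _; rewrite -mul_polyC rmorphM rmorphXn /=.
  by rewrite horner_algC horner_algX wX mulr_algl.
rewrite fock_act_sum big_image /= /on_top mulr_suml; apply: eq_bigr => i _.
by rewrite poisson_nseq_on_top // /on_top mulrA.
Qed.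

(** Multiplied from the right, the factors create functions that vanish at the empty
    stack and at the stacks whose top differs from the letter of the factor applied
    last: the coefficient of a factor at level [0] is its state, which vanishes. *)
Lemma poisson_free m (i : 'I_m -> I) : injective i ->
  free_family (fun t => word A [:: i t] : poisson_ncp).
Proof.
move=> i_inj k tau q k_gt0 q0 tau_alt.
pose Q j := horner_alg (word A [:: i (tau j)]) (q j).
(* [f n0] is the function created from the vacuum by the factors from [n0] on *)
pose f n0 := fock_act (\prod_(n0 <= j < k) Q j) (vacuum C).
have coef0 j : (j < k)%N ->
    \sum_(l < size (q j)) (q j)`_l * poisson_coef y l 0%N = 0.
  move=> /q0; rewrite /= poisson_state_act fock_act_horner //.
  by rewrite /on_top /= /vacuum mulr1.
suff H n0 : (n0 < k)%N -> f n0 [::] = 0 /\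
    forall t s, t != i (tau n0) -> f n0 (t :: s) = 0.
  by rewrite /= poisson_state_act -(big_mkord xpredT Q); case: (H _ k_gt0).
move: {-1}(k - n0)%N (erefl (k - n0)%N) => d.
elim: d n0 => [|d IH] n0 dE n0k; first by move: n0k; rewrite -subn_gt0 dE.
have fE : f n0 =1 on_top (i (tau n0))
    (fun j => \sum_(l < size (q n0)) (q n0)`_l * poisson_coef y l j) (f n0.+1).
  move=> s; rewrite /f big_ltn // fock_act_mul fock_act_horner // => s'.
  have [n0k'|kn0] := ltnP n0.+1 k.
    apply: (IH n0.+1 _ n0k').2; first by rewrite subnS dE.
    by rewrite (inj_eq i_inj) tau_alt.
  by rewrite big_geq // -word_nil fock_act_word.
split=> [|t s /negPf tn0]; rewrite fE /on_top /= ?tn0 coef0 // ?mul0r //.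
Qed.

End poisson_ncp.

(** * Expectations and independence *)

Section mean.
Context d (T : measurableType d) (R : realType) (P : probability T R).
Implicit Types (X Y H : T -> R).
Import HBNNSimple.

Definition mean X : R := fine 'E_P[X].

Definition L1 X := P.-integrable [set: T] (EFin \o X).

Lemma meanE X : mean X = (\int[P]_w X w)%R.
Proof. by rewrite /mean unlock. Qed.

Lemma mean_fin X : L1 X -> (\int[P]_w (X w)%:E = (mean X)%:E)%E.
Proof. by move=> iX; rewrite meanE /Rintegral fineK //; exact: integrable_fin_num. Qed.

Lemma L1_cst c : L1 (fun=> c).
Proof. exact: finite_measure_integrable_cst. Qed.

Lemma mean_cst c : mean (fun=> c) = c.
Proof.
by rewrite meanE (@Rintegral_cst _ _ _ P) //= probability_setT /= mulr1.
Qed.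

Lemma L1D X Y : L1 X -> L1 Y -> L1 (fun w => X w + Y w).
Proof. exact: integrableD. Qed.

Lemma meanD X Y : L1 X -> L1 Y -> mean (fun w => X w + Y w) = mean X + mean Y.
Proof. by move=> iX iY; rewrite !meanE RintegralD. Qed.

Lemma L1Z c X : L1 X -> L1 (fun w => c * X w).
Proof. exact: integrableZl. Qed.

Lemma meanZ c X : L1 X -> mean (fun w => c * X w) = c * mean X.
Proof. by move=> iX; rewrite !meanE RintegralZl. Qed.

Lemma L1_sum (J : Type) (r : seq J) (X : J -> T -> R) :
  (forall j, L1 (X j)) -> L1 (fun w => \sum_(j <- r) X j w).
Proof.
move=> iX; elim: r => [|j r IH].
  by under eq_fun do rewrite big_nil; exact: L1_cst.
by under eq_fun do rewrite big_cons; exact: L1D.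
Qed.

Lemma mean_sum (J : Type) (r : seq J) (X : J -> T -> R) :
  (forall j, L1 (X j)) -> mean (fun w => \sum_(j <- r) X j w) = \sum_(j <- r) mean (X j).
Proof.
move=> iX; elim: r => [|j r IH].
  by rewrite big_nil -[RHS](mean_cst 0); congr mean; apply/funext => w; rewrite big_nil.
rewrite big_cons -IH -meanD //; last exact: L1_sum.
by congr mean; apply/funext => w; rewrite big_cons.
Qed.

Lemma le_mean X Y : L1 X -> L1 Y -> (forall w, X w <= Y w) -> mean X <= mean Y.
Proof. by move=> iX iY XY; rewrite !meanE le_Rintegral. Qed.

Lemma L1N X : L1 X -> L1 (fun w => - X w).
Proof. exact: integrableN. Qed.

Lemma meanN X : L1 X -> mean (fun w => - X w) = - mean X.
Proof.
move=> iX; rewrite -mulN1r -meanZ //; congr mean.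
by apply/funext => w; rewrite mulN1r.
Qed.

Lemma norm_mean_le X Y : L1 X -> L1 Y -> (forall w, `|X w| <= Y w) ->
  `|mean X| <= mean Y.
Proof.
move=> iX iY XY; rewrite ler_norml -meanN //.
have XYw w : - Y w <= X w <= Y w by rewrite -ler_norml.
apply/andP; split; apply: le_mean => //; first exact: L1N.
  by move=> w; case/andP: (XYw w).
by move=> w; case/andP: (XYw w).
Qed.

Lemma mean_indic (A : set T) : measurable A -> mean (\1_A) = fine (P A).
Proof. by move=> mA; rewrite /mean expectation_indic. Qed.

Lemma L1_measurable X : L1 X -> measurable_fun setT X.
Proof. by move=> /integrableP[/measurable_EFinP]. Qed.

Lemma L1_indicM (A : set T) H : measurable A -> L1 H -> L1 (fun w => \1_A w * H w).
Proof.
move=> mA iH; apply: le_integrable (iH) => //.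
  apply/measurable_EFinP/measurable_funM; first exact: measurable_indic.
  exact: L1_measurable.
move=> w _ /=; rewrite lee_fin normrM ler_piMl //.
by rewrite indicE normr_nat lern1; case: (_ \in _).
Qed.

Lemma mean_dominated (X_ : nat -> T -> R) X Y : (forall n, measurable_fun setT (X_ n)) ->
  measurable_fun setT X -> L1 Y -> (forall w n, `|X_ n w| <= Y w) ->
  (forall w, X_ n w @[n --> \oo] --> X w) ->
  mean (X_ n) @[n --> \oo] --> mean X.
Proof.
move=> mX_ mX iY XY X_X.
have [|||||iX _] := @dominated_convergence _ _ _ P setT measurableT
   (fun n => EFin \o X_ n) (EFin \o X) (EFin \o Y).
- by move=> n; apply/measurable_EFinP.
- exact/measurable_EFinP.
- apply: aeW => w _; apply: cvg_EFin; last exact: X_X.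
  by apply: nearW => n.
- exact: iY.
- by apply: aeW => w n _ /=; rewrite lee_fin.
move=> /= ic.
have iX_ n : L1 (X_ n).
  apply: le_integrable iY => //; first exact/measurable_EFinP.
  by move=> w _ /=; rewrite lee_fin (le_trans (XY w n)) // ler_norm.
rewrite (mean_fin (X := X)) // in ic; have := fine_cvg ic.
rewrite (_ : fine \o _ = fun n => mean (X_ n)); first exact.
by apply/funext => n /=; rewrite mean_fin.
Qed.

(** If [H] is uncorrelated with the indicators of the events of [X], approximation
    of [X] by simple functions of [X] makes it uncorrelated with [X]. *)
Lemma mean_comp_mul X H (f : R -> R) : measurable_fun setT X ->
  (forall B, measurable B ->
     mean (fun w => \1_(X @^-1` B) w * H w) = fine (P (X @^-1` B)) * mean H) ->
  measurable_fun setT f -> (forall x, 0 <= f x) ->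
  L1 H -> L1 (fun w => f (X w)) -> L1 (fun w => f (X w) * H w) ->
  mean (fun w => f (X w) * H w) = mean (fun w => f (X w)) * mean H.
Proof.
move=> mX XH mf f0 iH ifX ifXH.
have mfE : measurable_fun setT (EFin \o f) by exact/measurable_EFinP.
pose s n := nnsfun_approx measurableT mfE n.
have s_le n x : s n x <= f x.
  have := @le_approx _ _ R setT (EFin \o f) n x; rewrite /s nnsfun_approxE.
  by apply => //= z _; rewrite lee_fin.
have s_ge0 n x : 0 <= s n x by [].
have s_cvg x : s n x @[n --> \oo] --> f x.
  have := @cvg_nnsfun_approx _ _ R setT measurableT (EFin \o f) mfE _ x Logic.I.
  by move=> /(_ (fun x _ => f0 x)) /fine_cvgP[].
have ms n : measurable_fun setT (fun w => s n (X w)).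
  exact: (measurableT_comp (@measurable_funP _ _ _ _ _ (s n))).
have mXB B : measurable B -> measurable (X @^-1` B).
  by move=> mB; rewrite -[_ @^-1` _]setTI; exact: mX.
have sE n w : s n (X w) =
    \sum_(v <- fset_set (range (s n))) v * \1_(X @^-1` (s n @^-1` [set v])) w.
  rewrite (fimfunE (s n)) fsbig_finite //=.
have isX n : L1 (fun w => s n (X w)).
  apply: le_integrable ifX => //; first exact/measurable_EFinP.
  by move=> w _ /=; rewrite lee_fin !ger0_norm.
have step n : mean (fun w => s n (X w) * H w) = mean (fun w => s n (X w)) * mean H.
  have mV v : measurable (X @^-1` (s n @^-1` [set v])) by apply: mXB.
  transitivity (\sum_(v <- fset_set (range (s n)))
      v * mean (fun w => \1_(X @^-1` (s n @^-1` [set v])) w * H w)).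
    have iV v : L1 (fun w => \1_(X @^-1` (s n @^-1` [set v])) w * H w).
      exact: L1_indicM.
    transitivity (\sum_(v <- fset_set (range (s n)))
        mean (fun w => v * (\1_(X @^-1` (s n @^-1` [set v])) w * H w))).
      rewrite -mean_sum; last by move=> v; exact: L1Z.
      congr mean; apply/funext => w; rewrite sE mulr_suml.
      by apply: eq_bigr => v _; rewrite mulrA.
    by apply: eq_bigr => v _; rewrite meanZ.
  under eq_bigr do rewrite XH // mulrA.
  rewrite -mulr_suml; congr (_ * _).
  have iV v : L1 \1_(X @^-1` (s n @^-1` [set v])) by exact: integrable_indic.
  transitivity (\sum_(v <- fset_set (range (s n)))
      mean (fun w => v * \1_(X @^-1` (s n @^-1` [set v])) w)).
    by apply: eq_bigr => v _; rewrite meanZ // mean_indic.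
  rewrite -mean_sum; last by move=> v; apply/L1Z.
  by congr mean; apply/funext => w; rewrite sE.
have c1 : mean (fun w => s n (X w) * H w) @[n --> \oo] -->
    mean (fun w => f (X w) * H w).
  apply: (mean_dominated _ _ (integrable_norm ifXH)).
  - by move=> n; apply: measurable_funM => //; exact: L1_measurable.
  - exact: L1_measurable.
  - by move=> w n /=; rewrite !normrM ler_wpM2r // !ger0_norm.
  - by move=> w; apply: cvgMl => //; exact: s_cvg.
have c2 : mean (fun w => s n (X w)) * mean H @[n --> \oo] -->
    mean (fun w => f (X w)) * mean H.
  apply: cvgMl; apply: (mean_dominated _ _ ifX) => //.
  - exact: L1_measurable.
  - by move=> w n /=; rewrite ger0_norm.
rewrite (_ : (fun n => _) = fun n => mean (fun w => s n (X w)) * mean H) in c1; last first.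
  by apply/funext.
exact: cvg_unique c1 c2.
Qed.

(** The positive and the negative part of [X] are nonnegative functions of [X]. *)
Lemma mean_mul_of_events X H :
  (forall B, measurable B ->
     mean (fun w => \1_(X @^-1` B) w * H w) = fine (P (X @^-1` B)) * mean H) ->
  L1 H -> L1 X -> L1 (fun w => X w * H w) ->
  mean (fun w => X w * H w) = mean X * mean H.
Proof.
move=> XH iH iX iXH; have mX := L1_measurable iX.
pose fp (x : R) : R := Num.max x 0; pose fn (x : R) : R := Num.max (- x) 0.
have mp : measurable_fun setT fp by exact: measurable_maxr.
have mn : measurable_fun setT fn by apply: measurable_maxr => //; exact: measurable_funN.
have E x : x = fp x - fn x.
  rewrite /fp /fn; case: (lerP x 0) => x0.
    by rewrite max_l ?oppr_ge0 // sub0r opprK.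
  by rewrite max_r ?subr0 // oppr_le0 ltW.
have fp_ge0 x : 0 <= fp x by rewrite le_max lexx orbT.
have fn_ge0 x : 0 <= fn x by rewrite le_max lexx orbT.
have fp_le x : fp x <= `|x| by rewrite ge_max ler_norm normr_ge0.
have fn_le x : fn x <= `|x| by rewrite ge_max -normrN ler_norm normr_ge0.
have dom (f : R -> R) : measurable_fun setT f -> (forall x, 0 <= f x) ->
    (forall x, f x <= `|x|) ->
    L1 (fun w => f (X w)) /\ L1 (fun w => f (X w) * H w).
  move=> mf f0 fle; have mfX : measurable_fun setT (fun w => f (X w)).
    exact: (measurableT_comp mf mX).
  split; [apply: le_integrable (iX)|apply: le_integrable (iXH)] => //.
  - exact/measurable_EFinP.
  - by move=> w _ /=; rewrite lee_fin ger0_norm.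
  - by apply/measurable_EFinP; apply: measurable_funM => //; exact: L1_measurable.
  - by move=> w _ /=; rewrite lee_fin !normrM ler_wpM2r // ger0_norm.
have [ip ipH] := dom _ mp fp_ge0 fp_le; have [in_ inH] := dom _ mn fn_ge0 fn_le.
have -> : mean X = mean (fun w => fp (X w)) - mean (fun w => fn (X w)).
  rewrite -meanN // -meanD //; last exact: L1N.
  by congr mean; apply/funext => w; rewrite -E.
rewrite mulrBl -!mean_comp_mul // -meanN // -meanD //; last exact: L1N.
by congr mean; apply/funext => w; rewrite {1}[X w]E mulrBl.
Qed.

End mean.

Section all_moments.
Context d (T : measurableType d) (R : realType) (P : probability T R).
Implicit Types (X Y H : T -> R).

(** The variables with all moments finite form an algebra, so that every polynomial
    in the entries is integrable. *)
Definition all_moments X : Prop := measurable_fun setT X /\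
  forall q : nat, ('E_P[fun w => (`|X w| ^+ q)%R] < +oo)%E.

Lemma measurable_normX X q : measurable_fun setT X ->
  measurable_fun setT (fun w => `|X w| ^+ q).
Proof. by move=> mX; apply: measurable_funX; exact: measurableT_comp. Qed.

Lemma L1_pow_of_all_moments X q : all_moments X -> L1 P (fun w => `|X w| ^+ q).
Proof.
move=> [mX /(_ q)]; rewrite unlock => Xq; apply/integrableP; split.
  exact/measurable_EFinP/measurable_normX.
by under eq_integral do rewrite /= ger0_norm ?exprn_ge0 //.
Qed.

Lemma L1_all_moments X : all_moments X -> L1 P X.
Proof.
move=> aX; have [mX _] := aX.
apply: le_integrable (L1_pow_of_all_moments 1 aX) => //; first exact/measurable_EFinP.
by move=> w _ /=; rewrite expr1 normr_id.
Qed.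

Lemma all_moments_le X (Y : nat -> T -> R) : measurable_fun setT X ->
  (forall q, L1 P (Y q)) -> (forall q w, `|X w| ^+ q <= Y q w) -> all_moments X.
Proof.
move=> mX iY XY; split=> // q; rewrite unlock.
have : L1 P (fun w => `|X w| ^+ q).
  apply: le_integrable (iY q) => //; first exact/measurable_EFinP/measurable_normX.
  move=> w _ /=; rewrite lee_fin ger0_norm ?exprn_ge0 //.
  by apply: le_trans (XY q w) _; rewrite ler_norm.
by move=> /integrableP[_]; under eq_integral do rewrite /= ger0_norm ?exprn_ge0 //.
Qed.

Lemma all_moments_cst c : all_moments (fun=> c).
Proof.
apply: (@all_moments_le _ (fun q => fun=> `|c| ^+ q)) => //.
by move=> q; exact: L1_cst.
Qed.

Lemma all_momentsM X Y : all_moments X -> all_moments Y ->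
  all_moments (fun w => X w * Y w).
Proof.
move=> aX aY.
apply: (@all_moments_le _ (fun q w => `|X w| ^+ (q + q) + `|Y w| ^+ (q + q))).
- by apply: measurable_funM; [case: aX|case: aY].
- by move=> q; apply: L1D; exact: L1_pow_of_all_moments.
- move=> q w; rewrite normrM exprMn !exprD; set a := `|X w| ^+ q; set b := _ ^+ q.
  have : 0 <= a by rewrite exprn_ge0.
  have : 0 <= b by rewrite exprn_ge0.
  nra.
Qed.

Lemma all_momentsD X Y : all_moments X -> all_moments Y ->
  all_moments (fun w => X w + Y w).
Proof.
move=> aX aY.
apply: (@all_moments_le _ (fun q w => 2 ^+ q * (`|X w| ^+ q + `|Y w| ^+ q))).
- by apply: measurable_funD; [case: aX|case: aY].
- by move=> q; apply/L1Z/L1D; exact: L1_pow_of_all_moments.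
- move=> q w; rewrite mulrDr -!exprMn.
  have [XY|/ltW YX] := lerP `|X w| `|Y w|.
  + apply: (@le_trans _ _ ((2 * `|Y w|) ^+ q)).
      rewrite lerXn2r ?nnegrE ?mulr_ge0 //.
      by apply: le_trans (ler_normD _ _) _; lra.
    by rewrite ler_wpDl // exprn_ge0 // mulr_ge0.
  + apply: (@le_trans _ _ ((2 * `|X w|) ^+ q)).
      rewrite lerXn2r ?nnegrE ?mulr_ge0 //.
      by apply: le_trans (ler_normD _ _) _; lra.
    by rewrite ler_wpDr // exprn_ge0 // mulr_ge0.
Qed.

Lemma all_moments_sum (J : Type) (r : seq J) (X : J -> T -> R) :
  (forall j, all_moments (X j)) -> all_moments (fun w => \sum_(j <- r) X j w).
Proof.
move=> aX; elim: r => [|j r IH].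
  by under eq_fun do rewrite big_nil; exact: all_moments_cst.
by under eq_fun do rewrite big_cons; exact: all_momentsD.
Qed.

Lemma all_moments_prod (J : Type) (r : seq J) (p : pred J) (X : J -> T -> R) :
  (forall j, all_moments (X j)) -> all_moments (fun w => \prod_(j <- r | p j) X j w).
Proof.
move=> aX; elim: r => [|j r IH].
  by under eq_fun do rewrite big_nil; exact: all_moments_cst.
by under eq_fun do rewrite big_cons; case: (p j) => //; exact: all_momentsM.
Qed.

Lemma all_moments_indic (A : set T) : measurable A -> all_moments \1_A.
Proof.
move=> mA; apply: (@all_moments_le _ (fun q => fun=> 1)).
- exact: measurable_indic.
- by move=> q; exact: L1_cst.
- by move=> q w; rewrite exprn_ile1 // indicE normr_nat lern1; case: (_ \in _).
Qed.

(** Independence of events, extended to products of random variables: indicators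
    are replaced one at a time by variables. *)
Lemma mean_prod_indep (I : choiceType) (D : set I) (F : I -> set_system T)
    (J : eqType) (blk : J -> I) (f : J -> T -> R) (r : seq J) :
  independent P D F ->
  (forall i A, F i A -> measurable A) ->
  (forall j, all_moments (f j)) ->
  (forall j B, measurable B -> F (blk j) (f j @^-1` B)) ->
  (forall j, j \in r -> D (blk j)) -> uniq (map blk r) ->
  mean P (fun w => \prod_(j <- r) f j w) = \prod_(j <- r) mean P (f j).
Proof.
move=> indep mF af Ff rD ur.
suff H (E : I -> set T) (s : seq I) : (forall i, i \in s -> D i /\ F i (E i)) ->
    uniq (map blk r ++ s) ->
    mean P (fun w => (\prod_(j <- r) f j w) * \prod_(i <- s) \1_(E i) w) =
    (\prod_(j <- r) mean P (f j)) * \prod_(i <- s) fine (P (E i)).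
  have := H (fun=> setT) [::]; rewrite cats0 !big_nil mulr1 => <- //.
  by congr mean; apply/funext => w; rewrite big_nil mulr1.
elim: r {ur} rD E s => [|j r IH] rD E s sD us.
  rewrite big_nil mul1r.
  pose J0 : {fset I} := [fset i in s]%fset.
  have mE i : i \in s -> measurable (E i) by move=> /sD[_]; exact: mF.
  have -> : (fun w => \prod_(j <- [::]) f j w * \prod_(i <- s) \1_(E i) w) =
      \1_(\bigcap_(i in [set` J0]) E i) :> (T -> R).
    apply/funext => w; rewrite big_nil mul1r indicE.
    have [wE|wE] := boolP (w \in _).
      rewrite big1_seq // => i /andP[_ si]; rewrite indicE mem_set //.
      by move: wE; rewrite inE; apply; rewrite /= inE.
    have [i si wi] : exists2 i, i \in s & ~ E i w.
      apply: contrapT => H; move/negP: wE; apply; rewrite inE => i /=.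
      by rewrite inE => si; apply: contrapT => wi; apply: H; exists i.
    by rewrite (big_rem i) //= indicE memNset // mul0r.
  rewrite mean_indic; last first.
    by apply: fin_bigcap_measurable => // i /=; rewrite inE => /mE.
  rewrite indep; last 2 first.
  - by move=> i /=; rewrite inE => /sD[].
  - by move=> i; rewrite inE => /sD[].
  rewrite (perm_big s) /=; last first.
    by apply: uniq_perm => // i; rewrite inE.
  rewrite big_seq [RHS]big_seq.
  have fP i : i \in s -> P (E i) = (fine (P (E i)))%:E.
    by move=> si; rewrite fineK // fin_num_measure //; exact: mE.
  under eq_bigr do rewrite fP //.
  by rewrite prodEFin.
have /and3P[jr js urs] : [&& blk j \notin map blk r, blk j \notin s & uniq (map blk r ++ s)].
  by move: us; rewrite /= mem_cat negb_or -andbA.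
have jD : D (blk j) by apply: rD; rewrite inE eqxx.
have rD' k : k \in r -> D (blk k) by move=> kr; apply: rD; rewrite inE kr orbT.
pose H w := (\prod_(k <- r) f k w) * \prod_(i <- s) \1_(E i) w.
have mE i : i \in s -> measurable (E i) by move=> /sD[_]; exact: mF.
have aH : all_moments H.
  apply: all_momentsM; first exact: all_moments_prod.
  have : forall i, i \in s -> measurable (E i) by [].
  elim: (s) => [_|i s' IHs ms].
    by under eq_fun do rewrite big_nil; exact: all_moments_cst.
  under eq_fun do rewrite big_cons; apply: all_momentsM.
    by apply/all_moments_indic/ms; rewrite inE eqxx.
  by apply: IHs => k ks; apply: ms; rewrite inE ks orbT.
have IHH : mean P H = (\prod_(k <- r) mean P (f k)) * \prod_(i <- s) fine (P (E i)).
  exact: IH.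
rewrite big_cons -mulrA -IHH.
have -> : (fun w => \prod_(k <- j :: r) f k w * \prod_(i <- s) \1_(E i) w) =
    fun w => f j w * H w.
  by apply/funext => w; rewrite big_cons /H mulrA.
apply: mean_mul_of_events; [|exact: L1_all_moments|exact: L1_all_moments|
  by apply/L1_all_moments/all_momentsM].
move=> B mB.
pose E' i := if i == blk j then f j @^-1` B else E i.
have E's i : i \in s -> E' i = E i.
  by rewrite /E' => si; case: eqP => // ij; rewrite -ij si in js.
have E'j : E' (blk j) = f j @^-1` B by rewrite /E' eqxx.
have := IH rD' E' (blk j :: s).
rewrite !big_cons E'j => /(_ _ _) IH'.
have sum' : \prod_(i <- s) fine (P (E' i)) = \prod_(i <- s) fine (P (E i)).
  by apply: eq_big_seq => i si; rewrite E's.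
transitivity (mean P (fun w => \prod_(k <- r) f k w * \prod_(i <- blk j :: s) \1_(E' i) w)).
  congr mean; apply/funext => w; rewrite big_cons E'j /H mulrCA; congr (_ * (_ * _)).
  by apply: eq_big_seq => i si; rewrite E's.
rewrite IH' ?sum' ?IHH; first by rewrite mulrCA.
- move=> i; rewrite inE => /orP[/eqP ->|si]; first by split=> //; rewrite E'j; exact: Ff.
  by rewrite E's //; exact: sD.
- by rewrite uniq_catC /= mem_cat negb_or js jr uniq_catC.
Qed.

End all_moments.

(** * Walks that use all edges twice *)

Section walks.
Context {I : eqType}.
Implicit Types (vis s : seq nat) (cs : seq I) (st : seq (I * nat)).

(** Rows and columns are numbered by the same integers; a step between a row and a
    column is recorded as an undirected edge, because [a i j] and [a j i] are not
    independent. *)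
Definition edge (c : I) (v u : nat) : I * (nat * nat) := (c, (minn v u, maxn v u)).

Definition block (k : I * (nat * nat)) := edge k.1 k.2.1 k.2.2.

(** The entries read by a walk; [e] tells that the walk stands at a row. *)
Fixpoint keys (e : bool) (v : nat) cs s : seq (I * (nat * nat)) :=
  if cs is c :: cs' then
    if s is u :: s' then (c, if e then (v, u) else (u, v)) :: keys (~~ e) u cs' s'
    else [::]
  else [::].

Fixpoint edges (v : nat) cs s : seq (I * (nat * nat)) :=
  if cs is c :: cs' then
    if s is u :: s' then edge c v u :: edges u cs' s' else [::]
  else [::].

Fixpoint fresh vis s : nat :=
  if s is u :: s' then
    if u \in vis then fresh vis s' else (fresh (u :: vis) s').+1
  else 0.

(** Depth-first exploration of a tree: each step discovers a new vertex, or returns to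
    the parent of the current vertex [v] in the colour of the edge between them.  The
    stack [st] lists the colours of the edges from [v] to the root and the parents. *)
Fixpoint good vis (v : nat) st cs s : bool :=
  match cs, s with
  | c :: cs', u :: s' =>
    if u \in vis then
      if st is (c', q) :: st' then
        [&& c == c', u == q & good vis q st' cs' s']
      else false
    else good (u :: vis) u ((c, v) :: st) cs' s'
  | [::], [::] => st == [::]
  | _, _ => false
  end.

Lemma edgeC c v u : edge c v u = edge c u v.
Proof. by rewrite /edge minnC maxnC. Qed.

Lemma edge_inj c c' v u u' : edge c v u = edge c' v u' -> c = c' /\ u = u'.
Proof. by case=> -> H1 H2; split=> //; lia. Qed.

Lemma map_block_keys e v cs s : map block (keys e v cs s) = edges v cs s.
Proof.
elim: cs e v s => //= c cs IH e v [|u s] //=; rewrite IH; congr (_ :: _).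
by case: e; rewrite // /block /= edgeC.
Qed.

Lemma size_keys e v cs s : size s = size cs -> size (keys e v cs s) = size s.
Proof.
elim: cs e v s => [|c cs IH] e v [|u s] //= [ss].
by congr _.+1; exact: IH.
Qed.

Definition within vis (b : I * (nat * nat)) := (b.2.1 \in vis) && (b.2.2 \in vis).

Lemma within_edge vis c v u : within vis (edge c v u) = (v \in vis) && (u \in vis).
Proof. by rewrite /within /edge /=; case: leqP; rewrite 1?andbC. Qed.

Lemma within_cons vis u b : within vis b -> within (u :: vis) b.
Proof. by rewrite /within !inE => /andP[-> ->]; rewrite !orbT. Qed.

(** What is left of the requirement that all edges be used twice, for the remaining
    edges [es] of a walk that has visited [vis]: the [pending] edges wait for their
    second use, and edges that leave [vis] have not been used at all. *)
Definition covered vis (pending es : seq (I * (nat * nat))) : Prop :=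
  {subset pending <= es} /\
  forall b, b \in es -> ~~ within vis b -> (1 < count_mem b es)%N.

Lemma covered_fresh vis pending es c v u :
  v \in vis -> u \notin vis -> all (within vis) pending ->
  covered vis pending (edge c v u :: es) ->
  covered (u :: vis) (edge c v u :: pending) es.
Proof.
move=> vv uv pv [pe cov]; set b := edge c v u.
have bN : ~~ within vis b by rewrite within_edge vv (negPf uv).
split=> [b'|b' b'e b'N].
  rewrite inE => /predU1P[->|b'p].
    have := cov b; rewrite inE eqxx => /(_ isT bN) /=.
    by rewrite eqxx add1n ltnS -has_count has_pred1.
  have := pe b' b'p; rewrite inE => /predU1P[b'b|//].
  by move/allP: pv => /(_ _ b'p); rewrite b'b (negPf bN).
have := cov b'; rewrite inE b'e orbT /= => /(_ isT).
have -> : (b == b') = false.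
  by apply: contraNF b'N => /eqP <-; rewrite within_edge !inE vv eqxx orbT.
by apply; apply: contra b'N; exact: within_cons.
Qed.

Lemma covered_old vis pending es c v u :
  v \in vis -> u \in vis -> uniq pending ->
  covered vis pending (edge c v u :: es) ->
  covered vis (rem (edge c v u) pending) es.
Proof.
move=> vv uv up [pe cov]; set b := edge c v u.
have bW : within vis b by rewrite within_edge vv uv.
split=> [b'|b' b'e b'N].
  rewrite mem_rem_uniq // !inE => /andP[/negPf b'b /pe].
  by rewrite inE b'b.
have := cov b'; rewrite inE b'e orbT /= => /(_ isT b'N).
by have -> : (b == b') = false by apply: contraNF b'N => /eqP <-.
Qed.

(** Each discovery creates an edge that has to be used again, and a step that
    discovers nothing uses at most one pending edge. *)
Lemma fresh_bound vis v pending cs s :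
  size s = size cs -> v \in vis -> uniq pending -> all (within vis) pending ->
  covered vis pending (edges v cs s) ->
  ((fresh vis s).*2 + size pending <= size s)%N.
Proof.
elim: cs vis v pending s => [|c cs IH] vis v pending [|u s] //=.
  by case: pending => // b p _ _ _ _ [/(_ b)]; rewrite inE eqxx => /(_ isT).
move=> [ss] vv up pv cov; case: ifPn => uv.
  have := IH vis u (rem (edge c v u) pending) s ss uv (rem_uniq _ up).
  move/(_ _ (covered_old vv uv up cov)).
  have -> : all (within vis) (rem (edge c v u) pending).
    by apply/allP => b /mem_rem; exact: (allP pv).
  move=> /(_ isT); case: (boolP (edge c v u \in pending)) => bp.
    have : (0 < size pending)%N by case: (pending) bp.
    by rewrite size_rem //; case: (size pending) => // k _ /=; rewrite addnS ltnS.
  by rewrite rem_id // => /leqW.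
have bN : edge c v u \notin pending.
  by apply/negP => /(allP pv); rewrite within_edge (negPf uv) andbF.
have := IH (u :: vis) u (edge c v u :: pending) s ss.
rewrite inE eqxx /= bN up within_edge !inE vv eqxx orbT /= => /(_ isT isT).
have -> : all (within (u :: vis)) pending.
  by apply/allP => b /(allP pv); exact: within_cons.
by move=> /(_ isT (covered_fresh vv uv pv cov)); lia.
Qed.

Fixpoint stack_edges (v : nat) st : seq (I * (nat * nat)) :=
  if st is (c, q) :: st' then edge c v q :: stack_edges q st' else [::].

Lemma size_stack_edges v st : size (stack_edges v st) = size st.
Proof. by elim: st v => //= -[c q] st IH v; congr _.+1; exact: IH. Qed.

Lemma mem_stack_edges v st b : b \in stack_edges v st ->
  (b.2.1 \in v :: map snd st) && (b.2.2 \in v :: map snd st).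
Proof.
elim: st v => //= -[c q] st IH v; rewrite inE => /predU1P[->|/IH].
  by rewrite -/(within _ _) within_edge !inE !eqxx orbT.
by rewrite !inE => /andP[/orP[/eqP ->|->] /orP[/eqP ->|->]]; rewrite ?eqxx !orbT.
Qed.

(** The vertices on the path to the root are distinct, so the only edge of the path at
    the current vertex is the last one. *)
Lemma stack_edges_top v c u c' q st : uniq (v :: map snd ((c', q) :: st)) ->
  edge c v u \in stack_edges v ((c', q) :: st) -> c = c' /\ u = q.
Proof.
move=> /= /andP[vN _]; rewrite inE => /predU1P[/edge_inj //|/mem_stack_edges].
rewrite -/(within _ _) within_edge => /andP[vq _].
by rewrite vq in vN.
Qed.

Lemma uniq_stack_edges v st : uniq (v :: map snd st) -> uniq (stack_edges v st).
Proof.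
elim: st v => //= -[c q] st IH v /= /andP[vN uq].
rewrite IH // andbT; apply: contra vN => /mem_stack_edges.
by rewrite -/(within _ _) within_edge => /andP[].
Qed.

(** In the case of equality of [fresh_bound] no step is wasted: a step that discovers
    nothing must use a pending edge.  These are the edges of the path to the root, so
    the step goes back to the parent. *)
Lemma tight_good vis v st cs s :
  size s = size cs -> {subset v :: map snd st <= vis} -> uniq (v :: map snd st) ->
  covered vis (stack_edges v st) (edges v cs s) ->
  ((fresh vis s).*2 + size st)%N = size s -> good vis v st cs s.
Proof.
elim: cs vis v st s => [|c cs IH] vis v st [|u s] //=.
  by case: st.
move=> [ss] stv ust cov.
have vv : v \in vis by apply: stv; rewrite inE eqxx.
have se_vis : all (within vis) (stack_edges v st).
  apply/allP => b /mem_stack_edges /andP[/stv b1 /stv b2].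
  by rewrite /within b1 b2.
have use := uniq_stack_edges ust.
case: ifPn => uv.
  have cov' := covered_old vv uv use cov.
  have rem_vis : all (within vis) (rem (edge c v u) (stack_edges v st)).
    by apply/allP => b /mem_rem; exact: (allP se_vis).
  have := fresh_bound ss uv (rem_uniq _ use) rem_vis cov'.
  have [bse _|bN] := boolP (edge c v u \in stack_edges v st); last first.
    by rewrite rem_id // size_stack_edges; lia.
  case: st {rem_vis} stv ust se_vis cov cov' use bse => //= -[c' q] st.
  move=> stv ust se_vis cov cov' use bse sz.
  have [cc uq] := stack_edges_top ust bse; subst c' q.
  rewrite !eqxx /=; apply: IH => //.
  - by move=> x xst; apply: stv; rewrite inE xst orbT.
  - by case/andP: ust.
  - by move: cov' => /=; rewrite eqxx.
  - by move: sz => /=; lia.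
move=> sz; apply: IH => //=.
- move=> x; rewrite !inE => /or3P[->//|/eqP ->|xst]; first by rewrite vv orbT.
  by rewrite (stv x) ?orbT // inE xst orbT.
- rewrite ust andbT; apply: contra uv; exact: stv.
- by rewrite edgeC; exact: covered_fresh.
- by lia.
Qed.

Lemma good_size vis v st cs s : good vis v st cs s ->
  size s = size cs /\ ((fresh vis s).*2 + size st)%N = size s.
Proof.
elim: cs vis v st s => [|c cs IH] vis v st [|u s] //=; first by move=> /eqP ->.
case: ifP => uv; last first.
  by move=> /IH[-> /= <-]; split=> //; rewrite doubleS addnS.
case: st => // -[c' q] st /and3P[_ _ /IH[-> /= <-]].
by split=> //; rewrite addnS.
Qed.

Lemma good_last vis v st cs s : good vis v st cs s ->
  last v s = last v (map snd st).
Proof.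
elim: cs vis v st s => [|c cs IH] vis v st [|u s] //=; first by move=> /eqP ->.
case: ifP => uv; last by move=> /IH ->.
by case: st => // -[c' q] st /and3P[_ /eqP -> /IH].
Qed.

(** The edge to a new vertex [u] is crossed back with the opposite parity [e], hence
    reads the same entry again.  The last clause carries the induction: the edges to
    vertices discovered later differ from those among the vertices of [vis]. *)
Lemma good_keys e vis v st cs s : good vis v st cs s ->
  {subset v :: map snd st <= vis} ->
  exists F, [/\ perm_eq (keys e v cs s)
      (keys e v (map fst st) (map snd st) ++ F ++ F),
    uniq (map block F) & all (fun k => ~~ within vis (block k)) F].
Proof.
elim: cs e vis v st s => [|c cs IH] e vis v st [|u s] //=.
  by move=> /eqP -> _; exists [::].
case: ifPn => uv gs sv; last first.
  have vv : v \in vis by apply: sv; rewrite inE eqxx.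
  have [x|F [pF uF wF]] := IH (~~ e) _ _ _ _ gs.
    rewrite /= !inE => /or3P[->//|/eqP ->|xst]; first by rewrite vv orbT.
    by rewrite (sv x) ?orbT // inE xst orbT.
  pose k := (c, if e then (v, u) else (u, v)).
  have kE : block k = edge c v u by case: (e) @k => //=; rewrite /block /= edgeC.
  exists (k :: F); split.
  - have kE' : (c, if ~~ e then (u, v) else (v, u)) = k by rewrite /k; case: (e).
    apply/permP => p; move/permP: pF => /(_ p).
    by rewrite /= kE' negbK !count_cat /= !count_cat /= => ->; rewrite -/k; lia.
  - rewrite /= uF andbT kE; apply/negP => /mapP[k' /(allP wF)] + kk.
    by rewrite -kk within_edge !inE vv eqxx orbT.
  - rewrite /= kE within_edge (negPf uv) andbF /=.
    by apply/allP => k' /(allP wF); apply: contra; exact: within_cons.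
case: st gs sv => // -[c' q] st /and3P[/eqP <- /eqP -> gs] sv.
have [x xst|F [pF uF wF]] := IH (~~ e) _ _ _ _ gs.
  by apply: sv; rewrite inE xst orbT.
by exists F; split=> //=; rewrite perm_cons.
Qed.

End walks.

Section walk_sums.
Context (R : realType).

Fixpoint walks (B : bool -> nat) (l : nat) (e : bool) : seq (seq nat) :=
  if l is l'.+1 then [seq u :: s | u <- iota 0 (B e), s <- walks B l' (~~ e)]
  else [:: [::]].

Lemma big_walksS B l e (F : seq nat -> R) :
  \sum_(s <- walks B l.+1 e) F s =
  \sum_(u <- iota 0 (B e)) \sum_(s <- walks B l (~~ e)) F (u :: s).
Proof. by rewrite /= big_allpairs_dep. Qed.

Lemma size_walks B l e s : s \in walks B l e -> size s = l.
Proof.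
by elim: l e s => [|l IH] e s /=; [rewrite inE => /eqP ->|
  move=> /allpairsP[[u s'] /= [_ /IH <- ->]]].
Qed.

Lemma count_iota_mem b (vis : seq nat) : (count (mem vis) (iota 0 b) <= size vis)%N.
Proof.
rewrite -size_filter; apply: uniq_leq_size; first exact: filter_uniq (iota_uniq _ _).
by move=> u; rewrite mem_filter => /andP[].
Qed.

Lemma sumr_count (J : Type) (r : seq J) (p : pred J) (x : R) :
  \sum_(u <- r | p u) x = (count p r)%:R * x.
Proof. by rewrite big_const_seq iter_addr_0 mulr_natl. Qed.

(** Summed with weight [x] per new vertex, all walks together weigh [O(1)]: at
    every step either one of boundedly many old vertices or one of [B] new ones. *)
Lemma sum_fresh_weight B (x D : R) l e vis : 0 <= x -> 0 <= D ->
  (forall e, x * (B e)%:R <= D) ->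
  \sum_(s <- walks B l e) x ^+ fresh vis s <= ((size vis + l)%:R + D) ^+ l.
Proof.
move=> x0 D0 BD; elim: l e vis => [|l IH] e vis; first by rewrite big_seq1 !expr0.
rewrite big_walksS (bigID (mem vis)) /=.
set c := (size vis + l.+1)%:R + D.
have c0 : 0 <= c by rewrite addr_ge0 ?ler0n.
have old : \sum_(u <- iota 0 (B e) | u \in vis)
    \sum_(s <- walks B l (~~ e))
      x ^+ (if u \in vis then fresh vis s else (fresh (u :: vis) s).+1)
    <= (size vis)%:R * c ^+ l.
  apply: (@le_trans _ _ (\sum_(u <- iota 0 (B e) | u \in vis) c ^+ l)).
    apply: ler_sum => u ->; apply: le_trans (IH _ _) _.
    by rewrite lerXn2r ?nnegrE ?addr_ge0 // lerD2r ler_nat; lia.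
  by rewrite sumr_count ler_wpM2r ?exprn_ge0 // ler_nat count_iota_mem.
have new : \sum_(u <- iota 0 (B e) | u \notin vis)
    \sum_(s <- walks B l (~~ e))
      x ^+ (if u \in vis then fresh vis s else (fresh (u :: vis) s).+1)
    <= D * c ^+ l.
  apply: (@le_trans _ _ (\sum_(u <- iota 0 (B e) | u \notin vis) x * c ^+ l)).
    apply: ler_sum => u /negPf ->; under eq_bigr do rewrite exprS.
    rewrite -mulr_sumr ler_wpM2l //; apply: le_trans (IH _ _) _.
    by rewrite lerXn2r ?nnegrE ?addr_ge0 // lerD2r ler_nat /=; lia.
  rewrite sumr_count mulrA ler_wpM2r ?exprn_ge0 //; apply: le_trans (BD e).
  rewrite mulrC ler_wpM2l // ler_nat.
  by apply: leq_trans (count_size _ _) _; rewrite size_iota.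
apply: le_trans (lerD old new) _; rewrite -mulrDl exprS ler_wpM2r ?exprn_ge0 //.
by rewrite lerD2r ler_nat; lia.
Qed.

End walk_sums.

(** * Counting tree walks *)

Section good_walks.
Context (R : realType) (I : finType) (y : R).

(** The limits of the numbers of columns and of rows, divided by [n]. *)
Definition hop_weight (e : bool) : R := if e then 1 else y.

Fixpoint walk_limit e (cs : seq I) : seq I -> R :=
  if cs is c :: cs' then hop (hop_weight e) c (walk_limit (~~ e) cs')
  else vacuum R.

Lemma walk_limit_doubled (w : seq I) :
  walk_limit true (flatten [seq [:: t; t] | t <- w]) = poisson_word y w (vacuum R).
Proof. by elim: w => //= t w ->. Qed.

Lemma walk_limit_le e cs f : `|walk_limit e cs f| <= (2 + `|y|) ^+ size cs.
Proof.
elim: cs e f => [|c cs IH] e f /=.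
  by rewrite expr0 /vacuum normr_nat lern1; case: (_ == _).
have w_le : `|hop_weight e| <= 1 + `|y|.
  by case: e; rewrite /= ?normr1 ?lerDl ?lerDr.
apply: le_trans (ler_normD _ _) _.
rewrite exprS; have -> : (2 + `|y|) * (2 + `|y|) ^+ size cs =
  (1 + `|y|) * (2 + `|y|) ^+ size cs + (2 + `|y|) ^+ size cs by ring.
rewrite lerD //; first by rewrite normrM ler_pM.
have C0 : 0 <= (2 + `|y|) ^+ size cs by rewrite exprn_ge0 // addr_ge0.
by case: f => [|t' f]; rewrite ?normr0 //; case: ifP => _; rewrite ?normr0.
Qed.

Context (Bn : nat -> bool -> nat) (x : nat -> R).
Hypothesis x_ge0 : forall p, 0 <= x p.
Hypothesis x_cvg0 : x p @[p --> \oo] --> 0.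
Hypothesis xB_cvg : forall e, (x p * (Bn p e)%:R : R) @[p --> \oo] --> hop_weight e.

Definition good_sum p e vis v st (cs : seq I) : R :=
  \sum_(s <- walks (Bn p) (size cs) e) (good vis v st cs s)%:R * x p ^+ fresh vis s.

(** The parents on the stack are alternately rows and columns, hence obey the
    bound of their kind; so a walk can always afford to return to its parent. *)
Fixpoint stack_ok p (e : bool) (st : seq (I * nat)) : bool :=
  if st is (c, q) :: st' then (q < Bn p e)%N && stack_ok p (~~ e) st' else true.

Lemma good_sum_cons p e vis v st c cs : {subset v :: map snd st <= vis} ->
  stack_ok p e st ->
  good_sum p e vis v st (c :: cs) =
  \sum_(u <- iota 0 (Bn p e) | u \notin vis)
     x p * good_sum p (~~ e) (u :: vis) u ((c, v) :: st) cs +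
  (if st is (c', q) :: st' then
     if c' == c then good_sum p (~~ e) vis q st' cs else 0 else 0).
Proof.
move=> sv ok; rewrite {1}/good_sum big_walksS (bigID (mem vis)) /= addrC.
congr (_ + _).
  apply: eq_bigr => u /negPf uv; rewrite uv mulr_sumr.
  by apply: eq_bigr => s _; rewrite exprS mulrCA.
case: st sv ok => [|[c' q] st] sv ok.
  by apply: big1 => u uv; apply: big1 => s _; rewrite uv mul0r.
have qv : q \in vis by apply: sv; rewrite !inE eqxx orbT.
move: ok => /= /andP[qB _].
transitivity (\sum_(u <- iota 0 (Bn p e) | u == q)
    if c' == c then good_sum p (~~ e) vis q st cs else 0).
  rewrite (bigID (pred1 q)) /= [X in _ + X]big1 => [|u /andP[uv /negPf uq]]; last first.
    by apply: big1 => s _; rewrite uv uq /= andbF mul0r.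
  rewrite addr0; apply: eq_big => [u|u /andP[uv /eqP ->]].
    by case: eqP => [->|]; rewrite ?qv ?andbF.
  rewrite eq_sym; case: ifP => cc.
    by apply: eq_bigr => s _; rewrite qv eqxx.
  by apply: big1 => s _; rewrite qv mul0r.
by rewrite -big_filter filter_pred1_uniq ?iota_uniq ?mem_iota // big_seq1.
Qed.

(** Fresh vertices avoid at most [K] old ones out of [Bn p e], so that a push
    contributes the factor [x p * Bn p e], up to a vanishing error that is uniform
    in the state of the walk. *)
Lemma good_sum_cvg cs K : exists err : nat -> R,
  [/\ err p @[p --> \oo] --> 0, forall p, 0 <= err p &
  forall p e vis v st, (size vis <= K)%N -> {subset v :: map snd st <= vis} ->
    (v < Bn p (~~ e))%N -> stack_ok p e st ->
    `|good_sum p e vis v st cs - walk_limit e cs (map fst st)| <= err p].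
Proof.
elim: cs K => [|c cs IH] K.
  exists (fun=> 0); split=> //; first exact: cvg_cst.
  move=> p e vis v st _ _ _ _; rewrite /good_sum /= big_seq1 expr0 mulr1 /vacuum.
  by case: st => [|[c q] st]; rewrite subrr normr0.
have [err [err0 err_ge0 errP]] := IH K.+1.
pose D p : R := x p * (Bn p true)%:R + x p * (Bn p false)%:R.
pose delta p : R := `|x p * (Bn p true)%:R - 1| +
  `|x p * (Bn p false)%:R - y| + K%:R * x p.
pose C : R := (2 + `|y|) ^+ size cs.
have C0 : 0 <= C by rewrite exprn_ge0 // addr_ge0.
have D0 p : 0 <= D p by rewrite addr_ge0 ?mulr_ge0.
have delta0 p : 0 <= delta p by rewrite !addr_ge0 ?mulr_ge0.
exists (fun p => D p * err p + delta p * C + err p); split.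
  have D_cvg : D p @[p --> \oo] --> 1 + y.
    exact: (cvgD (@xB_cvg true) (@xB_cvg false)).
  have delta_cvg : delta p @[p --> \oo] --> (0 : R).
    rewrite (_ : 0 = `|1 - 1| + `|y - y| + K%:R * 0); last by rewrite !subrr normr0 mulr0 !addr0.
    apply: cvgD; last by apply: cvgMr.
    apply: cvgD; apply: cvg_norm.
      by apply: (cvgB (@xB_cvg true)); exact: cvg_cst.
    by apply: (cvgB (@xB_cvg false)); exact: cvg_cst.
  rewrite (_ : 0 = (1 + y) * 0 + 0 * C + 0); last by rewrite mulr0 mul0r !addr0.
  by apply: cvgD => //; apply: cvgD; [exact: cvgM|exact: cvgMl].
  by move=> p; rewrite !addr_ge0 ?mulr_ge0.
move=> p e vis v st visK sv vB ok; rewrite good_sum_cons //= /hop.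
set M := walk_limit (~~ e) cs.
have vv : v \in vis by apply: sv; rewrite inE eqxx.
rewrite opprD addrACA; apply: le_trans (ler_normD _ _) _; apply: lerD; last first.
  case: st sv ok => [|[c' q] st] sv ok /=; first by rewrite subrr normr0.
  case: ifP => cc; last by rewrite subrr normr0.
  move: ok => /= /andP[qB ok]; apply: errP => //.
  - exact: leqW.
  - by move=> z zs; apply: sv; rewrite inE zs orbT.
  - by rewrite negbK.
(* the number of choices for a new vertex *)
pose N := count (predC (mem vis)) (iota 0 (Bn p e)).
have NB : (count (mem vis) (iota 0 (Bn p e)) + N = Bn p e)%N.
  by rewrite count_predC size_iota.
have NB' := leq_trans (count_iota_mem (Bn p e) vis) visK.
set f := c :: map fst st.
have -> : \sum_(u <- iota 0 (Bn p e) | u \notin vis)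
     x p * good_sum p (~~ e) (u :: vis) u ((c, v) :: st) cs - hop_weight e * M f =
  \sum_(u <- iota 0 (Bn p e) | u \notin vis)
     x p * (good_sum p (~~ e) (u :: vis) u ((c, v) :: st) cs - M f) +
  (N%:R * x p - hop_weight e) * M f.
  under [X in _ = X + _]eq_bigr do rewrite mulrBr.
  by rewrite sumrB sumr_count -/N; ring.
have xB_le : x p * (Bn p e)%:R <= D p.
  by rewrite /D; case: (e); rewrite ?lerDl ?lerDr mulr_ge0.
apply: le_trans (ler_normD _ _) _; apply: lerD.
  apply: le_trans (ler_norm_sum _ _ _) _.
  apply: (@le_trans _ _ (\sum_(u <- iota 0 (Bn p e) | u \notin vis) x p * err p)).
    rewrite big_seq_cond [leRHS]big_seq_cond; apply: ler_sum => u /andP[].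
    rewrite mem_iota add0n => /andP[_ uB] uv.
    rewrite normrM ger0_norm // ler_wpM2l //; apply: errP => //=.
    - move=> z; rewrite !inE => /or3P[->//|/eqP ->|zs]; first by rewrite vv orbT.
      by rewrite (sv z) ?orbT // inE zs orbT.
    - by rewrite negbK.
    - by rewrite vB negbK.
  rewrite sumr_count mulrA ler_wpM2r //; apply: le_trans xB_le.
  by rewrite mulrC ler_wpM2l // ler_nat -[leqRHS]NB leq_addl.
rewrite normrM ler_pM //; last exact: walk_limit_le.
have -> : N%:R * x p - hop_weight e = (x p * (Bn p e)%:R - hop_weight e) -
   (count (mem vis) (iota 0 (Bn p e)))%:R * x p.
  have NBR : (Bn p e)%:R = (count (mem vis) (iota 0 (Bn p e)))%:R + N%:R :> R.
    by rewrite -natrD NB.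
  by rewrite NBR; ring.
apply: le_trans (ler_normB _ _) _; apply: lerD.
  by case: (e); rewrite /= ?lerDl ?lerDr.
by rewrite ger0_norm ?mulr_ge0 // ler_wpM2r // ler_nat.
Qed.

End good_walks.

(** * Independence of the blocks of entries *)

Section sigma_algebras.
Context d (T : measurableType d) (R : realType).

Definition adapted (G : set_system T) (X : T -> R) :=
  forall B, measurable B -> G (X @^-1` B).

Lemma adaptedP (G : set_system T) X : sigma_algebra setT G ->
  adapted G X <-> measurable_fun (setT : set (g_sigma_algebraType G)) X.
Proof.
move=> sG; split=> [aX _ B mB|mX B mB].
  by rewrite setTI; apply: sub_sigma_algebra; exact: aX.
have := mX measurableT B mB; rewrite setTI.
by rewrite [X in X _ -> _]measurable_g_measurableTypeE.
Qed.

Lemma adapted_prod (G : set_system T) (J : Type) (r : seq J) (p : pred J)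
    (X : J -> T -> R) : sigma_algebra setT G ->
  (forall j, p j -> adapted G (X j)) ->
  adapted G (fun w => \prod_(j <- r | p j) X j w).
Proof.
move=> sG aX; apply/adaptedP => //; elim: r => [|j r IH].
  by under eq_fun do rewrite big_nil; exact: measurable_cst.
under eq_fun do rewrite big_cons; case: (boolP (p j)) => // pj.
by apply: measurable_funM => //; apply/adaptedP => //; exact: aX.
Qed.

Lemma sigma_algebra_sigma_rv d' (T' : measurableType d') (X : T -> T') :
  sigma_algebra setT (sigma_rv X).
Proof. exact/sigma_algebra_preimage/sigma_algebra_measurable. Qed.

Lemma sigma_rv_measurable d' (T' : measurableType d') (X : T -> T') A :
  measurable_fun setT X -> sigma_rv X A -> measurable A.
Proof. by move=> mX [B mB <-]; exact: mX. Qed.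

End sigma_algebras.

Section independent_entries.
Context d (T : measurableType d) (R : realType) (P : probability T R) (m : nat).
Context (a : 'I_m -> nat -> nat -> {RV P >-> R}).

Definition entry (k : 'I_m * (nat * nat)) : T -> R := a k.1 k.2.1 k.2.2.

Definition block_sigma (b : 'I_m * (nat * nat)) : set_system T :=
  entry_sigma (a b.1) b.2.

Lemma measurable_entry k : measurable_fun setT (entry k).
Proof. exact: measurable_funP. Qed.

Lemma measurable_entry_pair t i j :
  measurable_fun setT (fun w => (a t i j w, a t j i w)).
Proof. by apply: measurable_fun_pair; exact: measurable_funP. Qed.

Lemma sigma_algebra_block b : sigma_algebra setT (block_sigma b).
Proof.
by case: b => t [i j]; rewrite /block_sigma /entry_sigma /=; case: ifP => _;
  exact: sigma_algebra_sigma_rv.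
Qed.

Lemma block_sigma_measurable b A : block_sigma b A -> measurable A.
Proof.
case: b => t [i j]; rewrite /block_sigma /entry_sigma /=; case: ifP => _.
  by apply: sigma_rv_measurable; exact: measurable_funP.
by apply: sigma_rv_measurable; exact: measurable_entry_pair.
Qed.

(** The two entries of a block are measurable for the sigma-algebra of the array,
    hence so is their pair. *)
Lemma block_sigma_array b A : block_sigma b A -> array_sigma (a b.1) A.
Proof.
case: b => t [i j]; rewrite /block_sigma /entry_sigma /array_sigma /=.
set G := \bigcup_(ij in _) _.
have mG k l : measurable_fun (setT : set (g_sigma_algebraType G)) (a t k l).
  move=> _ B mB; apply: sub_sigma_algebra; exists (k, l) => //=.
  by exists B.
case: ifP => _ [B mB <-]; first exact: mG.
have : measurable_fun (setT : set (g_sigma_algebraType G))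
    (fun w => (a t i j w, a t j i w)) by exact: measurable_fun_pair.
exact.
Qed.

Lemma adapted_entry k : adapted (block_sigma (block k)) (entry k).
Proof.
case: k => t [i j]; rewrite /block /block_sigma /edge /entry /= => B mB.
case: (ltngtP i j) => [ij|ji|<-].
- rewrite /entry_sigma (ltn_eqF ij).
  by exists (fst @^-1` B); rewrite ?setTI // -[_ @^-1` _]setTI; exact: measurable_fst.
- rewrite /entry_sigma (ltn_eqF ji).
  by exists (snd @^-1` B); rewrite ?setTI // -[_ @^-1` _]setTI; exact: measurable_snd.
- rewrite /entry_sigma ?minnn ?maxnn eqxx.
  by exists B => //; rewrite setTI.
Qed.

(** Independence within and across the arrays combine into independence of all
    the blocks. *)
Lemma independent_blocks :
  (forall t, independent P [set ij | (ij.1 <= ij.2)%N] (entry_sigma (a t))) ->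
  independent P setT (fun t => array_sigma (a t)) ->
  independent P [set b : 'I_m * (nat * nat) | (b.2.1 <= b.2.2)%N] block_sigma.
Proof.
move=> entries arrays J JD E EJ.
have bE : forall b, b \in J -> measurable (E b).
  by move=> b /EJ; exact: block_sigma_measurable.
pose Et (t : 'I_m) := \bigcap_(b in [set b | (b \in J) && (b.1 == t)]) E b.
pose It : {fset 'I_m} := [fset t in enum 'I_m]%fset.
have finJ t : finite_set [set b | (b \in J) && (b.1 == t)].
  by apply: (sub_finite_set _ (finite_fset J)) => b /= /andP[].
have -> : \bigcap_(b in [set` J]) E b = \bigcap_(t in [set` It]) Et t.
  apply/seteqP; split=> w wE.
    by move=> t _ b /= /andP[bJ _]; exact: wE.
  move=> b bJ; apply: (wE b.1); last by rewrite /= bJ eqxx.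
  by rewrite /= inE mem_enum.
rewrite arrays; last 2 first.
- by [].
- move=> t _; rewrite /Et.
  have sG := @smallest_sigma_algebra T setT
    (\bigcup_(ij in [set: nat * nat]) sigma_rv (a t ij.1 ij.2)).
  rewrite /array_sigma; set G := \bigcup_(ij in _) _.
  apply: (@fin_bigcap_measurable _ (g_sigma_algebraType G)) => //.
  move=> b /= /andP[bJ /eqP bt]; have := block_sigma_array (EJ _ bJ).
  by rewrite bt.
rewrite (perm_big (enum 'I_m)) /=; last first.
  by apply: uniq_perm => [||t]; [exact: fset_uniq|exact: enum_uniq|rewrite inE].
rewrite big_enum /= (partition_big (fun b => b.1) xpredT) //=.
apply: eq_bigr => t _.
pose Jt : {fset nat * nat} := [fset b.2 | b in J & b.1 == t]%fset.
have JtP ij : (ij \in Jt) = ((t, ij) \in J).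
  apply/imfsetP/idP => [[[s ij'] /=]|tJ]; last first.
    by exists (t, ij) => //=; rewrite inE tJ /=.
  by rewrite !inE /= => /andP[sJ /eqP <-] ->.
have -> : Et t = \bigcap_(ij in [set` Jt]) E (t, ij).
  apply/seteqP; split=> w wE.
    by move=> ij /=; rewrite JtP => tJ; apply: wE => /=; rewrite tJ eqxx.
  move=> [s ij] /= /andP[sJ /eqP st]; rewrite st in sJ *.
  by apply: wE; rewrite /= JtP.
have JtD : [set` Jt] `<=` [set ij | (ij.1 <= ij.2)%N].
  by move=> ij /=; rewrite JtP => /JD.
have JtE ij : ij \in Jt -> entry_sigma (a t) ij (E (t, ij)) by rewrite JtP => /EJ.
rewrite (entries t Jt JtD (fun ij => E (t, ij)) JtE).
rewrite (perm_big [seq b.2 | b <- J & b.1 == t]) /=; last first.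
  apply: uniq_perm; first exact: fset_uniq.
    rewrite map_inj_in_uniq ?filter_uniq ?fset_uniq // => -[s ij] [s' ij'].
    by rewrite !mem_filter /= => /andP[/eqP -> _] /andP[/eqP -> _] ->.
  move=> ij; rewrite JtP; apply/idP/mapP => [tJ|[[s ij'] +] /= ->].
    by exists (t, ij); rewrite // mem_filter eqxx tJ.
  by rewrite mem_filter /= => /andP[/eqP ->].
rewrite big_map big_filter; apply: eq_bigr => -[s ij] /= /eqP -> //.
Qed.

End independent_entries.

(** * Means of products of entries *)

(** The largest factor dominates the product. *)
Lemma prod_le_sum_pow (R : realType) (J : eqType) (r : seq J) (z : J -> R) :
  (forall j, 0 <= z j) ->
  \prod_(j <- r) z j <= 1 + \sum_(j <- r) z j ^+ size r.
Proof.
move=> z0; have [->|r0] := eqVneq r [::]; first by rewrite !big_nil addr0.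
have [j0 jr0 jmax] : exists2 j0, j0 \in r & forall j, j \in r -> z j <= z j0.
  elim: r r0 => // j [|j' r] IH _.
    by exists j; rewrite ?inE // => j'; rewrite inE => /eqP ->.
  have [//|j1 j1r j1max] := IH; have [jj1|/ltW j1j] := lerP (z j) (z j1).
    exists j1; first by rewrite inE j1r orbT.
    by move=> k; rewrite inE => /predU1P[->|/j1max].
  exists j; first by rewrite inE eqxx.
  by move=> k; rewrite inE => /predU1P[->|/j1max kj1] //; exact: le_trans j1j.
apply: (@le_trans _ _ (z j0 ^+ size r)).
  have -> : z j0 ^+ size r = \prod_(j <- r) z j0.
    by rewrite big_const_seq count_predT iter_mulr_1.
  by rewrite big_seq [leRHS]big_seq; apply: ler_prod => j jr; rewrite z0 jmax.
by rewrite (big_rem j0) //= ler_wpDl // ler_wpDr // sumr_ge0 // => j _; rewrite exprn_ge0.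
Qed.

Section moments_of_words.
Context d (T : measurableType d) (R : realType) (P : probability T R) (m : nat).
Context (a : 'I_m -> nat -> nat -> {RV P >-> R}).
Hypothesis entries_indep :
  forall t, independent P [set ij | (ij.1 <= ij.2)%N] (entry_sigma (a t)).
Hypothesis arrays_indep : independent P setT (fun t => array_sigma (a t)).
Hypothesis mean0 : forall t i j, ('E_P[a t i j] = 0)%E.
Hypothesis var1 : forall t i j, ('E_P[fun w => (a t i j w ^+ 2)%R] = 1)%E.
Hypothesis moments : forall t (q : nat),
  (ereal_sup [set 'E_P[fun w => (`|a t ij.1 ij.2 w| ^+ q)%R]
             | ij in [set: nat * nat]] < +oo)%E.
Implicit Types (k : 'I_m * (nat * nat)) (ks : seq ('I_m * (nat * nat))).

Local Notation entry := (entry a).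

Lemma entry_moment_le_sup k q : ('E_P[fun w => (`|entry k w| ^+ q)%R] <=
  ereal_sup [set 'E_P[fun w => (`|a k.1 ij.1 ij.2 w| ^+ q)%R]
             | ij in [set: nat * nat]])%E.
Proof. by apply: ereal_sup_ubound; exists k.2. Qed.

Lemma all_moments_entry k : all_moments P (entry k).
Proof.
split; first exact: measurable_entry.
by move=> q; apply: le_lt_trans (entry_moment_le_sup k q) _; exact: moments.
Qed.

Lemma entry_moment_bound q : exists2 M : R, 0 <= M &
  forall k, mean P (fun w => `|entry k w| ^+ q) <= M.
Proof.
pose S t := ereal_sup [set 'E_P[fun w => (`|a t ij.1 ij.2 w| ^+ q)%R]%E
             | ij in [set: nat * nat]].
have S0 t : (0 <= S t)%E.
  apply: le_trans (entry_moment_le_sup (t, (0%N, 0%N)) q).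
  by apply: expectation_ge0 => w; rewrite exprn_ge0.
exists (\sum_t fine (S t)); first by rewrite sumr_ge0 // => t _; rewrite fine_ge0.
move=> k; apply: (@le_trans _ _ (fine (S k.1))).
  apply: fine_le; last exact: entry_moment_le_sup.
    rewrite ge0_fin_numE; first by case: (all_moments_entry k).
    by apply: expectation_ge0 => w; rewrite exprn_ge0.
  by rewrite ge0_fin_numE // moments.
by rewrite (bigD1 k.1) //= lerDl sumr_ge0 // => t _; rewrite fine_ge0.
Qed.

Definition word_mean ks : R := mean P (fun w => \prod_(k <- ks) entry k w).

Lemma word_mean_bound l : exists2 M : R, 0 <= M &
  forall ks, size ks = l -> `|word_mean ks| <= M.
Proof.
have [M M0 MP] := entry_moment_bound l.
exists (1 + l%:R * M); first by rewrite addr_ge0 ?mulr_ge0.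
move=> ks ksl.
have iS : L1 P (fun w => \sum_(k <- ks) `|entry k w| ^+ l).
  by apply: L1_sum => k; apply: L1_pow_of_all_moments; exact: all_moments_entry.
apply: (@le_trans _ _ (mean P (fun w => 1 + \sum_(k <- ks) `|entry k w| ^+ l))).
  apply: norm_mean_le.
  - by apply: L1_all_moments; apply: all_moments_prod => k; exact: all_moments_entry.
  - by apply: L1D => //; exact: L1_cst.
  - move=> w; rewrite normr_prod -ksl.
    exact: (@prod_le_sum_pow _ _ ks (fun k => `|entry k w|)).
rewrite meanD //; last exact: L1_cst.
rewrite mean_cst lerD2l mean_sum; last first.
  by move=> k; apply: L1_pow_of_all_moments; exact: all_moments_entry.
have <- : \sum_(k <- ks) M = l%:R * M by rewrite sumr_count count_predT ksl.
by apply: ler_sum => k _; exact: MP.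
Qed.

Lemma block_ordered k : ((block k).2.1 <= (block k).2.2)%N.
Proof. by rewrite /block /edge /=; lia. Qed.

(** Factors are grouped by blocks, since only different blocks are independent. *)
Lemma word_mean_factor ks : word_mean ks =
  \prod_(b <- undup (map block ks))
     mean P (fun w => \prod_(k <- ks | block k == b) entry k w).
Proof.
have indep := independent_blocks entries_indep arrays_indep.
rewrite -(mean_prod_indep (blk := id) indep).
- congr mean; apply/funext => w.
  rewrite (exchange_big_dep xpredT) //= [LHS]big_seq [RHS]big_seq.
  apply: eq_bigr => k kks; rewrite -big_filter.
  rewrite (eq_filter (a2 := pred1 (block k))); last by move=> b; rewrite /= eq_sym.
  by rewrite filter_pred1_uniq ?undup_uniq ?mem_undup ?map_f // big_seq1.
- by move=> b A; exact: block_sigma_measurable.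
- by move=> b; apply: all_moments_prod => k; exact: all_moments_entry.
- move=> b; apply: adapted_prod; first exact: sigma_algebra_block.
  by move=> k /eqP <-; exact: adapted_entry.
- by move=> b; rewrite mem_undup => /mapP[k _ ->]; exact: block_ordered.
- by rewrite map_id undup_uniq.
Qed.

(** An entry that is alone in its block is independent of all the other factors
    and centred. *)
Lemma word_mean_lonely ks : word_mean ks != 0 ->
  forall b, b \in map block ks -> (1 < count_mem b (map block ks))%N.
Proof.
move=> ks0 b bks; rewrite ltnNge; apply: contra ks0 => b1.
have : (0 < count_mem b (map block ks))%N by rewrite -has_count has_pred1.
move: b1; rewrite leq_eqVlt ltnS leqn0 => /orP[/eqP|/eqP -> //].
rewrite count_map -size_filter => b1 _.
have [k fk] : exists k, [seq k <- ks | block k == b] = [:: k].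
  by move: b1 => /=; case: [seq k <- ks | _] => [|k []] // _; exists k.
rewrite word_mean_factor (big_rem b) /=; last by rewrite mem_undup.
have -> : mean P (fun w => \prod_(k <- ks | block k == b) entry k w) = 0.
  transitivity (mean P (entry k)); last by rewrite /mean /entry mean0.
  by congr mean; apply/funext => w; rewrite -big_filter fk big_seq1.
by rewrite mul0r.
Qed.

Lemma word_mean_pairs ks F : perm_eq ks (F ++ F) -> uniq (map block F) ->
  word_mean ks = 1.
Proof.
move=> ksF uF; rewrite /word_mean.
have indep := independent_blocks entries_indep arrays_indep.
transitivity (mean P (fun w => \prod_(k <- F) entry k w ^+ 2)).
  congr mean; apply/funext => w; rewrite (perm_big _ ksF) big_cat /= -big_split /=.
  by apply: eq_bigr => k _; rewrite expr2.
rewrite (mean_prod_indep (blk := block) indep) //.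
- by rewrite big1 // => k _; rewrite /mean /entry var1.
- by move=> b A; exact: block_sigma_measurable.
- by move=> k; under eq_fun do rewrite expr2; apply: all_momentsM; exact: all_moments_entry.
- move=> k; have sk := sigma_algebra_block a (block k).
  apply/(adaptedP _ sk)/measurable_funX/(adaptedP _ sk); exact: adapted_entry.
- by move=> k _; exact: block_ordered.
Qed.

End moments_of_words.

(** * Expansion of the moments over walks *)

Definition doubled (I : Type) (w : seq I) := flatten [seq [:: t; t] | t <- w].

Lemma size_doubled (I : Type) (w : seq I) : size (doubled w) = (size w).*2.
Proof. by elim: w => //= t w ->. Qed.

Section expansion.
Context d (T : measurableType d) (R : realType) (P : probability T R) (m : nat).
Context (a : 'I_m -> nat -> nat -> {RV P >-> R}) (n : nat -> nat).

(** The numbers of vertices that a walk can step to, from a row and from a column. *)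
Definition side p (e : bool) : nat := if e then n p else p.

Definition step p : R := (n p)%:R^-1.

Lemma sum_ord_iota (k : nat) (F : nat -> R) :
  \sum_(u < k) F u = \sum_(u <- iota 0 k) F u.
Proof. by rewrite -(big_mkord xpredT) /index_iota subn0. Qed.

Lemma sample_covE t p w (i u : 'I_p) : sample_cov (a t) n p w i u =
  step p * \sum_(j <- iota 0 (n p)) a t i j w * a t u j w.
Proof.
rewrite /sample_cov !mxE; congr (_ * _).
rewrite -(sum_ord_iota _ (fun j => a t i j w * a t u j w)).
by apply: eq_bigr => j _; rewrite !mxE.
Qed.

Lemma prod_sample_covE p w tau (i i' : 'I_p) :
  (\prod_(t <- tau) sample_cov (a t) n p w) i i' =
  step p ^+ size tau *
  \sum_(s <- walks (side p) (size tau).*2 true | last (i : nat) s == i')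
     \prod_(k <- keys true i (doubled tau) s) entry a k w.
Proof.
elim: tau i => [|t tau IH] i.
  by rewrite big_nil mxE /= mul1r big_cons !big_nil addr0 mulrb.
rewrite big_cons -mulmxE mxE /=.
pose G (j u : nat) := a t i j w * a t u j w *
  \sum_(s <- walks (side p) (size tau).*2 true | last u s == i')
     \prod_(k <- keys true u (doubled tau) s) entry a k w.
transitivity (step p ^+ (size tau).+1 *
    \sum_(j <- iota 0 (n p)) \sum_(u <- iota 0 p) G j u).
  rewrite exchange_big /= mulr_sumr.
  rewrite -(sum_ord_iota _ (fun u =>
    step p ^+ (size tau).+1 * \sum_(j <- iota 0 (n p)) G j u)).
  apply: eq_bigr => u _; rewrite IH sample_covE exprS -!mulrA; congr (_ * _).
  by rewrite mulrCA; congr (_ * _); rewrite mulr_suml.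
congr (_ * _); rewrite [RHS]big_mkcond /=.
rewrite big_allpairs_dep; apply: eq_bigr => j _.
rewrite big_allpairs_dep; apply: eq_bigr => u _.
rewrite /G mulr_sumr [RHS]/= -[RHS]big_mkcond /=.
by apply: eq_bigr => s _; rewrite !big_cons mulrA.
Qed.

Hypothesis aM : forall k, all_moments P (entry a k).

Lemma finite_moments_sample_cov t p : finite_moments P (sample_cov (a t) n p).
Proof.
move=> i u; rewrite -/(all_moments P (fun w => sample_cov (a t) n p w i u)).
under eq_fun do rewrite sample_covE.
apply: all_momentsM; first exact: all_moments_cst.
apply: all_moments_sum => j.
by apply: all_momentsM; [exact: (aM (t, (_, _)))|exact: (aM (t, (_, _)))].
Qed.

Lemma phi_expansion p tau :
  phi P (fun w => \prod_(t <- tau) sample_cov (a t) n p w) =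
  p%:R^-1 * \sum_(v <- iota 0 p)
    \sum_(s <- walks (side p) (size tau).*2 true | last v s == v)
     step p ^+ size tau * word_mean a (keys true v (doubled tau) s).
Proof.
rewrite /phi -/(mean P _); congr (_ * _).
have aK ks : L1 P (fun w => \prod_(k <- ks) entry a k w).
  by apply: L1_all_moments; apply: all_moments_prod.
transitivity (mean P (fun w => \sum_(v <- iota 0 p)
    \sum_(s <- [seq s <- walks (side p) (size tau).*2 true | last v s == v])
     step p ^+ size tau * \prod_(k <- keys true v (doubled tau) s) entry a k w)).
  congr mean; apply/funext => w; rewrite /mxtrace.
  rewrite -(sum_ord_iota _ (fun v =>
    \sum_(s <- [seq s <- walks (side p) (size tau).*2 true | last v s == v])
     step p ^+ size tau * \prod_(k <- keys true v (doubled tau) s) entry a k w)).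
  by apply: eq_bigr => v _; rewrite prod_sample_covE big_filter mulr_sumr.
rewrite mean_sum; last by move=> v; apply: L1_sum => s; exact: L1Z.
apply: eq_bigr => v _; rewrite mean_sum; last by move=> s; exact: L1Z.
by rewrite big_filter; apply: eq_bigr => s _; rewrite meanZ.
Qed.

End expansion.

(** * Convergence of the moments *)

Section limit.
Context d (T : measurableType d) (R : realType) (P : probability T R) (m : nat).
Context (a : 'I_m -> nat -> nat -> {RV P >-> R}) (n : nat -> nat) (y : R).
Hypothesis entries_indep :
  forall t, independent P [set ij | (ij.1 <= ij.2)%N] (entry_sigma (a t)).
Hypothesis arrays_indep : independent P setT (fun t => array_sigma (a t)).
Hypothesis mean0 : forall t i j, ('E_P[a t i j] = 0)%E.
Hypothesis var1 : forall t i j, ('E_P[fun w => (a t i j w ^+ 2)%R] = 1)%E.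
Hypothesis moments : forall t (q : nat),
  (ereal_sup [set 'E_P[fun w => (`|a t ij.1 ij.2 w| ^+ q)%R]
             | ij in [set: nat * nat]] < +oo)%E.
Hypothesis y_gt0 : 0 < y.
Hypothesis ratio : (p%:R / (n p)%:R : R) @[p --> \oo] --> y.

Local Notation x := (step R n).
Local Notation Bn := (side n).

Let x_ge0 p : 0 <= x p. Proof. by rewrite invr_ge0. Qed.

Let x_le1 p : x p <= 1.
Proof.
rewrite /step; case: (n p) => [|k]; first by rewrite invr0.
by rewrite invf_le1 // ler1n.
Qed.

Let x_cvg0 : x p @[p --> \oo] --> (0 : R).
Proof.
have inv_cvg0 : (p%:R^-1 : R) @[p --> \oo] --> (0 : R).
  apply/gtr0_cvgV0; last exact: cvgr_idn.
  by near=> p; rewrite ltr0n; near: p; exact: nbhs_infty_gt.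
have : (p%:R / (n p)%:R * p%:R^-1 : R) @[p --> \oo] --> y * 0 by exact: cvgM.
rewrite mulr0; apply: cvg_trans; apply: near_eq_cvg; near=> p.
rewrite /= mulrAC mulfV ?mul1r // pnatr_eq0 -lt0n.
by near: p; exact: nbhs_infty_gt.
Unshelve. all: by end_near.
Qed.

Let side_cvg e : (x p * (Bn p e)%:R : R) @[p --> \oo] --> hop_weight y e.
Proof.
case: e => /=; last by under eq_fun do rewrite mulrC.
apply: cvg_near_cst.
have : \forall p \near \oo, (0 : R) < p%:R / (n p)%:R by exact: (cvgr_gt _ ratio).
apply: filterS => p /=; rewrite /step; case: (n p) => [|k _]; last by rewrite mulVf.
by rewrite invr0 mulr0 ltxx.
Qed.

(** A walk that is not good either has vanishing mean, or visits so few vertices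
    that its normalisation leaves a spare factor [1 / n]. *)
Lemma walk_defect p (v : nat) (tau : seq 'I_m) (s : seq nat) (M : R) : 0 <= M ->
  size s = (size tau).*2 ->
  (forall ks, size ks = (size tau).*2 -> `|word_mean a ks| <= M) ->
  `| (if last v s == v
      then x p ^+ size tau * word_mean a (keys true v (doubled tau) s) else 0)
     - (good [:: v] v [::] (doubled tau) s)%:R * x p ^+ fresh [:: v] s | <=
  M * x p * x p ^+ fresh [:: v] s.
Proof.
move=> M0 ss bM.
have scs : size s = size (doubled tau) by rewrite size_doubled.
have [g|ng] := boolP (good _ _ _ _ _).
  have [_ /=] := good_size g; rewrite addn0 ss => /double_inj fE.
  rewrite (good_last g) /= eqxx mul1r fE.
  have sub : {subset v :: map snd ([::] : seq ('I_m * nat)) <= [:: v]}.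
    by move=> u; rewrite inE.
  have [F [pF uF _]] := good_keys true g sub.
  rewrite (word_mean_pairs entries_indep arrays_indep var1 moments pF uF) mulr1.
  by rewrite subrr normr0 !mulr_ge0 ?exprn_ge0.
rewrite mul0r subr0; case: ifP => _; last first.
  by rewrite normr0 !mulr_ge0 ?exprn_ge0.
have [->|ks0] := eqVneq (word_mean a (keys true v (doubled tau) s)) 0.
  by rewrite mulr0 normr0 !mulr_ge0 ?exprn_ge0.
have lone := word_mean_lonely entries_indep arrays_indep mean0 moments ks0.
rewrite map_block_keys in lone.
have cov : covered [:: v] [::] (edges v (doubled tau) s).
  by split=> // b be _; exact: lone.
have vv : v \in [:: v] by rewrite inE.
have := fresh_bound (pending := [::]) scs vv isT isT cov; rewrite addn0 ss leq_double leq_eqVlt.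
case/orP => [/eqP fE|fl].
  by case/negP: ng; apply: tight_good => //; rewrite fE addn0 ss.
rewrite normrM ger0_norm ?exprn_ge0 // mulrC -mulrA -exprS; apply: ler_pM => //.
- by rewrite exprn_ge0.
- by apply: bM; rewrite size_keys.
- exact: ler_wiXn2l.
Qed.

(** Good walks yield the limit, and the other walks a term of order [1 / n]; both
    estimates are uniform in the starting vertex. *)
Lemma phi_cvg (tau : seq 'I_m) :
  phi P (fun w => \prod_(t <- tau) sample_cov (a t) n p w) @[p --> \oo] -->
  fock_moment y tau.
Proof.
have aM := all_moments_entry moments.
have [M M0 bM] := word_mean_bound moments (size tau).*2.
have [err [err0 err_ge0 errP]] :=
  good_sum_cvg x_ge0 x_cvg0 side_cvg (doubled tau) 1.
set k := size tau.
pose D p : R := x p * (Bn p true)%:R + x p * (Bn p false)%:R.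
pose W p : R := ((1 + k.*2)%:R + D p) ^+ k.*2.
have D_cvg : D p @[p --> \oo] --> 1 + y.
  exact: (cvgD (@side_cvg true) (@side_cvg false)).
have D0 p : 0 <= D p by rewrite addr_ge0 ?mulr_ge0.
have bound p : (0 < p)%N ->
    `|phi P (fun w => \prod_(t <- tau) sample_cov (a t) n p w) - fock_moment y tau|
    <= err p + M * x p * W p.
  move=> p0; rewrite phi_expansion // -/k.
  pose f v := \sum_(s <- walks (Bn p) k.*2 true | last v s == v)
     x p ^+ k * word_mean a (keys true v (doubled tau) s).
  have fP v : v \in iota 0 p -> `|f v - fock_moment y tau| <= err p + M * x p * W p.
    rewrite mem_iota add0n => /andP[_ vp].
    rewrite -(subrKA (good_sum Bn x p true [:: v] v [::] (doubled tau))) addrC.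
    apply: le_trans (ler_normD _ _) _; apply: lerD.
      by have := errP p true [:: v] v [::] isT; rewrite /= walk_limit_doubled; apply.
    rewrite /f /good_sum size_doubled -/k big_mkcond -sumrB.
    apply: le_trans (ler_norm_sum _ _ _) _.
    apply: (@le_trans _ _ (\sum_(s <- walks (Bn p) k.*2 true) M * x p * x p ^+ fresh [:: v] s)).
      rewrite big_seq [leRHS]big_seq; apply: ler_sum => s /size_walks ss.
      exact: walk_defect.
    rewrite -mulr_sumr ler_wpM2l ?mulr_ge0 //.
    apply: sum_fresh_weight => // e.
    by rewrite /D; case: e; rewrite ?lerDl ?lerDr mulr_ge0.
  have -> : fock_moment y tau = p%:R^-1 * \sum_(v <- iota 0 p) fock_moment y tau.
    by rewrite sumr_count count_predT size_iota mulrA mulVf ?mul1r // pnatr_eq0 -lt0n.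
  rewrite -mulrBr -sumrB normrM ger0_norm ?invr_ge0 // ler_pdivrMl ?ltr0n //.
  apply: le_trans (ler_norm_sum _ _ _) _.
  apply: (@le_trans _ _ (\sum_(v <- iota 0 p) (err p + M * x p * W p))).
    by rewrite big_seq [leRHS]big_seq; apply: ler_sum => v /fP.
  by rewrite sumr_count count_predT size_iota.
have bound0 : (err p + M * x p * W p : R) @[p --> \oo] --> (0 : R).
  have Wc : W p @[p --> \oo] --> ((1 + k.*2)%:R + (1 + y)) ^+ k.*2.
    have c : ((1 + k.*2)%:R + D p : R) @[p --> \oo] --> (1 + k.*2)%:R + (1 + y).
      by apply: cvgD; [exact: cvg_cst|exact: D_cvg].
    apply: (@cvg_comp _ _ _ _ (fun z : R => z ^+ k.*2) _ _ _ c).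
    exact: exprn_continuous.
  rewrite (_ : 0 = 0 + M * 0 * (((1 + k.*2)%:R + (1 + y)) ^+ k.*2)); last first.
    by rewrite mulr0 mul0r addr0.
  apply: cvgD => //; apply: cvgM; last exact: Wc.
  by apply: cvgM; [exact: cvg_cst|exact: x_cvg0].
apply/cvgrPdist_le => e e0.
have near_e : \forall p \near \oo, `|0 - (err p + M * x p * W p)| <= e.
  by move/cvgrPdist_le : bound0; apply.
near=> p.
rewrite distrC; apply: le_trans (bound p _) _; first by near: p; exact: nbhs_infty_gt.
have : `|0 - (err p + M * x p * W p)| <= e by near: p; exact: near_e.
by rewrite sub0r normrN; apply: le_trans; exact: ler_norm.
Unshelve. all: by end_near.
Qed.

End limit.

(** * Asymptotic freeness *)

Lemma cvg_real_complex (R : realType) (u : nat -> R) (l : R) :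
  u p @[p --> \oo] --> l -> ((u p)%:C%C : R[i]^o) @[p --> \oo] --> (l%:C%C : R[i]^o).
Proof.
move=> /cvgrPdist_le ul; apply/cvgrPdist_le => e e0.
have [e_re e_gt0] : e = (complex.Re e)%:C%C /\ 0 < complex.Re e.
  by move: e e0 => [er ei]; rewrite ltcE /= => /andP[/eqP -> ->].
near=> p.
rewrite -rmorphB /= e_re normc_def /= expr0n /= addr0 sqrtr_sqr lecR.
by near: p; exact: ul.
Unshelve. all: by end_near.
Qed.

Theorem theorem4 (R : realType) (d : measure_display) (T : measurableType d)
    (P : probability T R) (m : nat) (rho : 'I_m -> nat -> R)
    (a : 'I_m -> nat -> nat -> {RV P >-> R}) (n : nat -> nat) (y : R)
    (entries_indep : forall t,
       independent P [set ij | (ij.1 <= ij.2)%N] (entry_sigma (a t)))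
    (mean0 : forall t i j, ('E_P[a t i j] = 0)%E)
    (var1 : forall t i j, ('E_P[fun w => (a t i j w ^+ 2)%R] = 1)%E)
    (moments : forall t (q : nat),
       (ereal_sup [set 'E_P[fun w => (`|a t ij.1 ij.2 w| ^+ q)%R]
                  | ij in [set: nat * nat]] < +oo)%E)
    (corr : forall t i j, i != j ->
       ('E_P[fun w => (a t i j w * a t j i w)%R] = (rho t `|i - j|%N)%:E)%E)
    (arrays_indep : independent P setT (fun t => array_sigma (a t)))
    (y_gt0 : 0 < y)
    (ratio : (p%:R / (n p)%:R : R) @[p --> \oo] --> y) :
  asymptotically_free P (fun t => sample_cov (a t) n).
Proof.
split.
- by move=> t p w; rewrite /sample_cov linearZ /= trmx_mul trmxK.
- move=> t p; apply: finite_moments_sample_cov.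
  exact: all_moments_entry.
have yC : 0 <= (y%:C%C : R[i]) by rewrite lecR ltW.
exists (poisson_ncp 'I_m yC), (fun t => word _ [:: t]); split.
- by move=> t; rewrite /= star_word.
- move=> tau /=.
  rewrite (_ : \prod_(t <- tau) word _ [:: t] = word (free_star_algebra_exists 'I_m R[i]) tau).
    rewrite poisson_state_word -fock_moment_morph.
    apply: cvg_real_complex; exact: phi_cvg.
  elim: tau => [|t tau IH]; first by rewrite big_nil word_nil.
  by rewrite big_cons IH -word_cat.
- exact: (@poisson_free _ _ _ yC m id).
Qed.
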